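(* Let $\{\tilde S_n\}_{n\ge1}$ be the random walk with echoed steps with memory parameter $p$, spin law $X$ and echo law $\xi$, satisfying the standing hypotheses. Suppose $p\,m_1\le1$. Then there exists $\gamma>1$ such that: (i) If $pm_1=1$ and $\mathbb E[\xi\log\xi]<m_1$, then $$\lim_{n\to\infty}\frac{\tilde S_n}{n\log n}=(1-p)\,\mathbb E X\quad\text{almost surely and in }L^\gamma(\mathbb P).$$ (ii) If $pm_1<1$, then $$\lim_{n\to\infty}\frac{\tilde S_n}{n}=\frac{(1-p)\,\mathbb E X}{1-pm_1}\quad\text{almost surely and in }L^\gamma(\mathbb P).$$
   Context: Standing hypotheses: $p\in(0,1]$; $X$ and $\xi$ are real random variables with $\mathbb P(X=0)<1$, $\mathbb P(\xi=0)<1$, $\xi\ge0$ a.s., and $X,\xi\in L^\alpha(\mathbb P)$ for some $\alpha>1$. Random walk with echoed steps (RWES): let $\{X_n\}_{n\ge1}$ be i.i.d. copies of $X$ (the spins), $\{\varepsilon_n\}_{n\ge2}$ i.i.d. Bernoulli$(p)$, $\{\mathcal U[n]\}_{n\ge2}$ independent with $\mathcal U[n]$ uniform on $\{1,\dots,n-1\}$, $\{\xi_n\}_{n\ge2}$ i.i.d. copies of $\xi$ (the echo variables), all these families being mutually independent. Set $$\tilde X_1=X_1,\qquad \tilde X_n=(1-\varepsilon_n)X_n+\varepsilon_n\xi_n\tilde X_{\mathcal U[n]}\ (n\ge2),\qquad \tilde S_n=\tilde X_1+\cdots+\tilde X_n .$$ Notation: $m_\gamma=\mathbb E\,\xi^\gamma$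 for $\gamma\in\mathbb R$; $0\log0=0$. *)

(* Defs.v *)
From HB Require Import structures.
From mathcomp Require Export all_boot all_order all_algebra.
From mathcomp Require Export all_classical all_reals all_analysis.

Set Implicit Arguments.
Unset Strict Implicit.
Unset Printing Implicit Defensive.

Import Order.TTheory GRing.Theory Num.Theory.
Import numFieldNormedType.Exports.

Local Open Scope classical_set_scope.
Local Open Scope ring_scope.

Section probability_notions.
Context (d : measure_display) (T : measurableType d) (R : realType).
Variable P : probability T R.

Definition same_law (d' : measure_display) (T' : measurableType d')
    (X Y : {RV P >-> T'}) : Prop :=
  forall A : set T', measurable A -> distribution P X A = distribution P Y A.

Definition sigma_of (d' : measure_display) (T' : measurableType d')
    (X : {RV P >-> T'}) : set (set T) :=
  preimage_set_system setT X measurable.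

(* Product rule over every finite subfamily of [(F i)_(i in D)], a subfamily
   being given by an injective enumeration [j] of its indices. *)
Definition mutually_independent (I : Type) (D : set I)
    (F : I -> set (set T)) : Prop :=
  forall (n : nat) (j : 'I_n -> I) (E : 'I_n -> set T),
    injective j ->
    (forall k, D (j k)) ->
    (forall k, F (j k) (E k)) ->
    (P (\big[setI/setT]_(k < n) E k) = \prod_(k < n) P (E k))%E.

Definition cvg_as (Y : nat -> T -> R) (l : R) : Prop :=
  {ae P, forall w, Y n w @[n --> \oo] --> l}.

Definition cvg_Lp (g : R) (Y : nat -> T -> R) (l : R) : Prop :=
  (forall n, Y n \in Lfun P g%:E) /\
  (Lnorm P g%:E (fun w => (Y n w - l)%:E) @[n --> \oo] --> 0)%E.

End probability_notions.

Section echoed_walk.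
Context (d : measure_display) (T : measurableType d) (R : realType).
Variable P : probability T R.
Variables (Xs : nat -> {RV P >-> R}) (eps : nat -> {RV P >-> bool}).
Variables (U : nat -> {RV P >-> nat}) (xis : nat -> {RV P >-> R}).

(* [echo_table n w] lists the echoed steps of index 0, 1, ..., n at w, with a
   dummy 0 at index 0. If [U n w] falls outside {1, ..., n - 1}, which is a null
   event for the walk, the recalled step is 0. *)
Fixpoint echo_table (n : nat) (w : T) : seq R :=
  match n with
  | 0 => [:: 0]
  | 1 => [:: 0; Xs 1 w]
  | n'.+1 =>
      let t := echo_table n' w in
      rcons t ((1 - (eps n w)%:R) * Xs n w
               + (eps n w)%:R * xis n w * nth 0 t (U n w))
  end.

Definition echo_step (n : nat) (w : T) : R := nth 0 (echo_table n w) n.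

Definition echo_walk (n : nat) (w : T) : R := \sum_(1 <= k < n.+1) echo_step k w.

Lemma size_echo_table n w : size (echo_table n w) = n.+1.
Proof. by elim: n => [|[|n] IH] //; rewrite /= size_rcons -/(echo_table _ w) IH. Qed.

Lemma nth_echo_table n k w : (k <= n)%N ->
  nth 0 (echo_table n w) k = echo_step k w.
Proof.
elim: n => [|n IH]; first by rewrite leqn0 => /eqP ->.
rewrite leq_eqVlt => /orP[/eqP -> //|]; rewrite ltnS => kn; rewrite -(IH kn).
case: n kn {IH} => [|n] kn; first by move: kn; rewrite leqn0 => /eqP ->.
by rewrite [echo_table n.+2 w]/= -/(echo_table n.+1 w) nth_rcons
  size_echo_table ltnS kn.
Qed.

Lemma echo_step1 w : echo_step 1 w = Xs 1 w.
Proof. by []. Qed.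

Lemma echo_stepE n w : (2 <= n)%N -> (1 <= U n w < n)%N ->
  echo_step n w = (1 - (eps n w)%:R) * Xs n w
                  + (eps n w)%:R * xis n w * echo_step (U n w) w.
Proof.
case: n => [|[|n]] // _ /andP[_ Un].
rewrite /echo_step [echo_table n.+2 w]/= -/(echo_table n.+1 w) nth_rcons.
by rewrite size_echo_table ltnn eqxx (@nth_echo_table n.+1).
Qed.

Inductive rwes_index : Type :=
  | Spin of nat | Coin of nat | Recall of nat | Echo of nat.

Definition rwes_domain : set rwes_index := fun i =>
  match i with
  | Spin n => (1 <= n)%N
  | Coin n | Recall n | Echo n => (2 <= n)%N
  end.

Definition rwes_sigma (i : rwes_index) : set (set T) :=
  match i with
  | Spin n => sigma_of (Xs n)
  | Coin n => sigma_of (eps n)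
  | Recall n => sigma_of (U n)
  | Echo n => sigma_of (xis n)
  end.

(* The values of [Xs] at 0 and of [eps], [U], [xis] at 0 and 1 are unused and
   unconstrained. *)
Record is_rwes_data (p : R) (X xi : {RV P >-> R}) : Prop := IsRwesData {
  rwes_spin : forall n, (1 <= n)%N -> same_law (Xs n) X ;
  rwes_coin : forall n, (2 <= n)%N ->
    forall A : set bool, distribution P (eps n) A = bernoulli_prob p A ;
  rwes_recall : forall n, (2 <= n)%N -> forall k : nat,
    distribution P (U n) [set k] =
      (if (1 <= k < n)%N then (n.-1%:R^-1)%:E else 0%:E) ;
  rwes_echo : forall n, (2 <= n)%N -> same_law (xis n) xi ;
  rwes_indep : mutually_independent P rwes_domain rwes_sigma
}.

End echoed_walk.

(* Main.v *)
From HB Require Import structures.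
Require Import Defs.
From mathcomp Require Import measurable_realfun ring lra zify.
Import Order.TTheory GRing.Theory Num.Theory.
Import numFieldNormedType.Exports.
Set Implicit Arguments.
Unset Strict Implicit.
Unset Printing Implicit Defensive.
Local Open Scope classical_set_scope.
Local Open Scope ring_scope.

(* The walk is linear in the spins, so it suffices to treat nonnegative spins,
   for which the walk is nondecreasing.  Write q = p m_1 and Z_n for the centered
   walk.  Conditionally on the past, the expected next step is
   (1 - p) E X + q S_n / n, whence E S_n is explicit up to o(n), resp. o(n log n).
   Choose 1 < g <= 2 with p m_g < g: this is possible because t^(1+h) is
   t + h t log t + O(h^2), so that p m_(1+h) < 1 + h for small h under either
   hypothesis.  The same one-step identity for g-th powers bounds E step_n^g by
   a power of n with exponent less than g - 1, and the inequality
   |x + y|^g <= |x|^g + g sgn(x) |x|^(g-1) y + 2 g |y|^g turns it into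
   E |Z_(n+1)|^g <= (1 + g q / n) E |Z_n|^g + O(n^(b-1)) with b < g.
   Hence E |Z_n|^g is O(n^g), and O(n^b) with b < g when q < 1, so the normalized
   centered walk has g-th moment O((log n)^(-g)): this is the L^g convergence.
   Since sum 1 / (n (log n)^g) converges, the sum of |Z_n / a_n|^g weighted by
   log n - log (n - 1) is a.s. finite, and monotonicity of the walk upgrades this
   to convergence along all n: a deviation at N would persist on a block of
   indices around N of fixed logarithmic length. *)

(** Only moments of some order above 1 are assumed, so a second-moment martingale argument is out of
    reach and an exponent [g] in (1, 2] takes its place. No conditional expectation is formed: the
    one-step identity is an equation between integrals [E [F step^s]] for nonnegative weights [F]
    that depend on the past. With [F = 1] it governs the mean and the moments of the steps; with
    [s = 1] and [F] a signed part of [sgn(Z) |Z|^(g-1)] it evaluates the cross term in the expansion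
    of [|Z_(n+1)|^g]. In the critical case the homogeneous recursion for [E |Z_n|^g] already grows
    like [n^g], so no power of [n] is gained and all the decay comes from the logarithm in the
    norming. Since [(log n)^(-g)] is not summable over all [n], Borel-Cantelli along all indices
    fails; this is why logarithmic weights and monotonicity enter. *)

Section real_powers.
Context {R : realType}.
Implicit Types a b x y t h g : R.

(** Convexity of [t^g] in tangent form, [b^g >= a^g + g a^(g-1) (b - a)], rearranged into Young's
    inequality for [a^(g-1)] and [b] with exponents [g/(g-1)] and [g]; no derivative is taken. *)
Lemma powR_tangent g a b : 1 < g -> 0 <= a -> 0 <= b ->
  g * (a `^ (g - 1) * b) <= b `^ g + (g - 1) * a `^ g.
Proof.
move=> g1 a0 b0.
have g0 : 0 < g by exact: lt_trans g1.
have gB0 : 0 < g - 1 by rewrite subr_gt0.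
have := @conjugate_powR R (a `^ (g - 1)) b (g / (g - 1)) g (powR_ge0 _ _) b0.
rewrite divr_gt0// invf_div => /(_ isT g0).
rewrite -powRrM.
have -> : (g - 1) * (g / (g - 1)) = g by field; rewrite gt_eqF.
have -> : (g - 1) / g + g^-1 = 1 by field; rewrite gt_eqF.
move=> /(_ erefl); rewrite -(ler_pM2l g0) mulrDr.
have -> : g * (a `^ g * ((g - 1) / g)) = (g - 1) * a `^ g by field; rewrite gt_eqF.
have -> : g * (b `^ g / g) = b `^ g by field; rewrite gt_eqF.
by rewrite [X in _ <= X]addrC.
Qed.

Lemma powR_bernoulli g x : 1 <= g -> 0 <= x -> 1 + g * x <= (1 + x) `^ g.
Proof.
rewrite le_eqVlt => /predU1P[<- x0|g1 x0].
  by rewrite mul1r powRr1// addr_ge0.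
have := @powR_tangent g 1 (1 + x) g1 ler01 (addr_ge0 ler01 x0).
by rewrite !powR1; lra.
Qed.

(** The ratios [a/(a+b)] and [b/(a+b)] lie in (0, 1], where [t <= t^h], and they add up to 1. *)
Lemma powRD_subadd h a b : 0 < h -> h <= 1 -> 0 <= a -> 0 <= b ->
  (a + b) `^ h <= a `^ h + b `^ h.
Proof.
move=> h0 h1; rewrite le_eqVlt => /predU1P[<- b0|a0].
  by rewrite add0r powR0 ?gt_eqF// add0r.
rewrite le_eqVlt => /predU1P[<-|b0].
  by rewrite addr0 powR0 ?gt_eqF// addr0.
have ab0 : 0 < a + b by rewrite addr_gt0.
have ratio c : 0 < c -> c <= a + b -> (a + b) `^ h * (c / (a + b)) <= c `^ h.
  move=> c0 cab; have := @ger1_powR R (c / (a + b)) h.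
  rewrite divr_gt0// ler_pdivrMr// mul1r => /(_ cab h1).
  rewrite -(ler_pM2l (powR_gt0 h ab0)) => /le_trans; apply.
  by rewrite -powRM ?divr_ge0 ?(ltW c0) ?(ltW ab0)// mulrC divfK ?gt_eqF.
have aab : a <= a + b by rewrite lerDl ltW.
have bab : b <= a + b by rewrite lerDr ltW.
have := lerD (ratio a a0 aab) (ratio b b0 bab).
by rewrite -mulrDr -mulrDl divff ?gt_eqF// mulr1.
Qed.

(* The derivative of [|x| `^ (h + 1) / (h + 1)]. *)
Definition spow h x : R := if 0 <= x then x `^ h else - (- x) `^ h.

Lemma spow_ge0 h x : 0 <= x -> spow h x = x `^ h.
Proof. by rewrite /spow => ->. Qed.

Lemma spowN h x : h != 0 -> spow h (- x) = - spow h x.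
Proof.
move=> h0; rewrite /spow oppr_ge0 opprK.
case: (ltrgt0P x) => //; first by rewrite opprK.
by move=> ->; rewrite oppr0 powR0// oppr0.
Qed.

Lemma norm_spow h x : `|spow h x| = `|x| `^ h.
Proof.
rewrite /spow; case: (leP 0 x) => x0; first by rewrite !ger0_norm ?powR_ge0.
by rewrite normrN ger0_norm ?powR_ge0// ltr0_norm.
Qed.

Lemma mul_spow h x : 0 < h -> spow h x * x = `|x| `^ (h + 1).
Proof.
move=> h0; rewrite /spow; have h1 : 0 < h + 1 by rewrite addr_gt0.
have E y : 0 <= y -> y * y `^ h = y `^ (h + 1).
  by move=> y0; have := mulr_powRB1 y0 h1; rewrite addrK.
case: (leP 0 x) => x0; first by rewrite mulrC E ?ger0_norm.
by rewrite ltr0_norm// -E ?oppr_ge0 1?ltW// !mulNr mulrC.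
Qed.

(** By symmetry and oddness one may take [y <= x] and [0 <= x]. For equal signs this is
    subadditivity; for opposite signs each of [x^h] and [(-y)^h] is at most [(x-y)^h], whence the
    factor 2. *)
Lemma spow_hoelder h x y : 0 < h -> h <= 1 ->
  `|spow h x - spow h y| <= 2 * `|x - y| `^ h.
Proof.
move=> h0 h1; have h00 : h != 0 by rewrite gt_eqF.
wlog xy : x y / y <= x.
  move=> H; case: (leP y x) => [|/ltW] xy; first exact: H.
  by rewrite distrC (distrC x); exact: H.
wlog x0 : x y xy / 0 <= x.
  move=> H; case: (leP 0 x) => x0; first exact: H.
  have := H (- y) (- x); rewrite lerN2 oppr_ge0 => /(_ xy (ltW (le_lt_trans xy x0))).
  by rewrite !spowN// !opprK addrC [- y + _]addrC.
have := powR_ge0 `|x - y| h.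
rewrite (@ger0_norm _ (x - y)) ?subr_ge0// => p0.
case: (leP 0 y) => y0.
  rewrite !spow_ge0// ger0_norm; last by rewrite subr_ge0 ge0_ler_powR ?nnegrE// ltW.
  have := @powRD_subadd h (x - y) y h0 h1; rewrite subr_ge0 subrK => /(_ xy y0); lra.
rewrite spow_ge0// /spow (leNgt 0 y) y0/= opprK ger0_norm; last by rewrite addr_ge0 ?powR_ge0.
have A : x `^ h <= (x - y) `^ h by rewrite ge0_ler_powR ?nnegrE ?subr_ge0//; lra.
have B : (- y) `^ h <= (x - y) `^ h by rewrite ge0_ler_powR ?nnegrE ?subr_ge0//; lra.
lra.
Qed.

Lemma norm_powR_tangent g x y : 1 < g ->
  `|x| `^ g + g * spow (g - 1) x * (y - x) <= `|y| `^ g.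
Proof.
move=> g1; have g10 : 0 < g - 1 by lra.
have := @powR_tangent g `|x| `|y| g1 (normr_ge0 _) (normr_ge0 _).
have := @mul_spow (g - 1) x g10; rewrite subrK => E.
have : spow (g - 1) x * y <= `|x| `^ (g - 1) * `|y|.
  by rewrite -norm_spow -normrM ler_norm.
rewrite -(ler_pM2l (lt_trans ltr01 g1)).
rewrite mulrBr -(mulrA g _ x) E -(mulrA g _ y); lra.
Qed.

(** The tangent at [x + y], evaluated at [x], gives this bound with the slope taken at [x + y].
    Moving the slope back to [x] costs [g |u - v| |y|], which the Hoelder bound of exponent
    [g - 1 <= 1] turns into [2 g |y|^g]. *)
Lemma norm_powRD_le g x y : 1 < g -> g <= 2 ->
  `|x + y| `^ g <= `|x| `^ g + g * spow (g - 1) x * y + 2 * g * `|y| `^ g.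
Proof.
move=> g1 g2; have g0 : 0 < g by exact: lt_trans g1.
have := @norm_powR_tangent g (x + y) x g1.
rewrite (_ : x - (x + y) = - y); last by ring.
have h0 : 0 < g - 1 by lra.
have h1 : g - 1 <= 1 by lra.
have := @spow_hoelder (g - 1) (x + y) x h0 h1.
rewrite (_ : x + y - x = y); last by ring.
set u := spow _ _; set v := spow _ _ => uv.
have : (u - v) * y <= 2 * `|y| `^ g.
  apply: (le_trans (ler_norm _)); rewrite normrM.
  rewrite -(mulr_powRB1 (normr_ge0 y) g0) mulrCA [leRHS]mulrC.
  by rewrite ler_wpM2r// [_ * 2]mulrC.
rewrite -(ler_pM2l g0).
have -> : g * ((u - v) * y) = g * u * y - g * v * y by ring.
have -> : g * (2 * `|y| `^ g) = 2 * g * `|y| `^ g by ring.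
rewrite mulrN; lra.
Qed.

Lemma norm_powRD_le2 g x y : 0 < g ->
  `|x + y| `^ g <= 2 `^ g * (`|x| `^ g + `|y| `^ g).
Proof.
move=> g0.
wlog xy : x y / `|x| <= `|y|.
  move=> H; case: (leP `|x| `|y|) => [/H//|/ltW/H].
  by rewrite addrC [`|y| `^ g + _]addrC.
apply: (@le_trans _ _ ((2 * `|y|) `^ g)).
  rewrite ge0_ler_powR ?nnegrE ?mulr_ge0// ?(ltW g0)//.
  by rewrite (le_trans (ler_normD _ _))// mulrDl !mul1r lerD2r.
by rewrite powRM// ler_wpM2l ?powR_ge0// lerDr powR_ge0.
Qed.

(** Both factors are compared with the larger of [a] and [b]. This crude form suffices to dominate
    products such as [|Z|^(g-1) step] by integrable functions. *)
Lemma powR_young g a b : 1 <= g -> 0 <= a -> 0 <= b ->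
  a `^ (g - 1) * b <= a `^ g + b `^ g.
Proof.
rewrite le_eqVlt => /predU1P[<- a0 b0|g1 a0 b0].
  by rewrite subrr powRr0 mul1r !powRr1// lerDr.
have g0 : 0 < g by exact: lt_trans g1.
have h0 : 0 <= g - 1 by lra.
case: (leP a b) => ab.
  apply: (@le_trans _ _ (b `^ g)); last by rewrite lerDr powR_ge0.
  by rewrite -(mulr_powRB1 b0 g0) mulrC ler_wpM2l// ge0_ler_powR ?nnegrE.
apply: (@le_trans _ _ (a `^ g)); last by rewrite lerDl powR_ge0.
by rewrite -(mulr_powRB1 a0 g0) mulrC ler_wpM2r ?powR_ge0// ltW.
Qed.

Lemma ler_1DpowR g a : 1 <= g -> 0 <= a -> a <= 1 + a `^ g.
Proof. by move=> g1 a0; have := powR_young g1 ler01 a0; rewrite !powR1 mul1r. Qed.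

Lemma ler_powR_1D (s : R) g a : 0 <= s -> s <= g -> 0 <= a -> a `^ s <= 1 + a `^ g.
Proof.
move=> s0 sg a0; case: (leP a 1) => a1.
  apply: (@le_trans _ _ (1 `^ s)); first by rewrite ge0_ler_powR ?nnegrE.
  by rewrite powR1 lerDl powR_ge0.
by rewrite (@le_trans _ _ (a `^ g)) ?ler_powR ?lerDr// ltW.
Qed.

End real_powers.

(** * Linear recursions with coefficients [1 + a / n] and their growth *)

Section rising_products.
Context {R : realType}.
Implicit Types a b c g q : R.

(** This is Gamma(n + a) / (Gamma(n) Gamma(1 + a)), of order [n^a]. Being the exact solution of the
    homogeneous recursion, it replaces [n^a] in all comparisons. *)
Definition rising a n : R := \prod_(1 <= k < n) (1 + a / k%:R).

Lemma rising1 a : rising a 1 = 1.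
Proof. by rewrite /rising big_geq. Qed.

Lemma risingS a n : (0 < n)%N -> rising a n.+1 = (1 + a / n%:R) * rising a n.
Proof. by move=> n0; rewrite /rising big_nat_recr//= mulrC. Qed.

Lemma factor_ge1 a n : 0 <= a -> 1 <= 1 + a / n%:R.
Proof. by move=> a0; rewrite lerDl divr_ge0. Qed.

Lemma rising_ge1 a n : 0 <= a -> 1 <= rising a n.
Proof.
move=> a0; rewrite /rising; elim/big_ind : _ => //= [x y x1 y1|k _].
  by rewrite -[1]mulr1 ler_pM.
exact: factor_ge1.
Qed.

Lemma rising_gt0 a n : 0 <= a -> 0 < rising a n.
Proof. by move=> a0; rewrite (lt_le_trans ltr01)// rising_ge1. Qed.

Lemma rising_id n : (0 < n)%N -> rising 1 n = n%:R.
Proof.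
elim: n => // -[_ _|n /(_ isT) IH _]; first by rewrite rising1.
by rewrite risingS// IH mul1r mulrDl mul1r mulVf ?pnatr_eq0// natr1.
Qed.

Lemma ler_rising a b n : 0 <= a -> a <= b -> rising a n <= rising b n.
Proof.
move=> a0 ab; apply: ler_prod => k _; rewrite addr_ge0 ?divr_ge0//=.
by rewrite lerD2l ler_wpM2r.
Qed.

Lemma rising_ge_n a n : 1 <= a -> (0 < n)%N -> n%:R <= rising a n.
Proof. by move=> a1 n0; rewrite -{1}(rising_id n0) ler_rising. Qed.

Lemma rising_le_powR a n : 1 <= a -> (0 < n)%N -> rising a n <= n%:R `^ a.
Proof.
move=> a1; elim: n => // -[_ _|n /(_ isT) IH _]; first by rewrite rising1 powR1.
have a0 : 0 <= a by lra.
rewrite risingS//.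
have -> : n.+2%:R = (1 + n.+1%:R^-1) * n.+1%:R :> R.
  by rewrite mulrDl mul1r mulVf ?pnatr_eq0// natr1.
rewrite powRM// ?addr_ge0//; apply: ler_pM => //.
- by rewrite addr_ge0// divr_ge0.
- by rewrite ltW// rising_gt0.
- exact: powR_bernoulli.
Qed.

(** A multiple [K * rising b] exceeds the homogeneous recursion of rate [a] by
    [K (b - a) rising b n / n] at each step, and this absorbs the source once [K (b - a) >= c]. *)
Lemma subcritical_growth a b c (u : nat -> R) : 0 <= a -> a < b -> 0 <= c ->
  (forall n, (0 < n)%N ->
    u n.+1 <= (1 + a / n%:R) * u n + c * (rising b n / n%:R)) ->
  exists2 K, 0 <= K & forall n, (0 < n)%N -> u n <= K * rising b n.
Proof.
move=> a0 ab c0 hu; have b0 : 0 <= b by lra.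
pose K : R := `|u 1%N| + c / (b - a).
have ba0 : 0 < b - a by lra.
have K0 : 0 <= K by rewrite addr_ge0// divr_ge0// ltW.
exists K => //; elim=> // -[_ _|n /(_ isT) IH _].
  by rewrite rising1 mulr1 /K (le_trans (ler_norm _))// lerDl divr_ge0// ltW.
apply: (le_trans (hu _ _)) => //; rewrite (risingS b (ltn0Sn n)).
set r := rising b _ in IH *; set N : R := n.+1%:R.
have N0 : 0 < N by rewrite ltr0n.
apply: (@le_trans _ _ ((1 + a / N) * (K * r) + c * (r / N))).
  by rewrite lerD2r ler_wpM2l// addr_ge0// divr_ge0// ltW.
have r0 : 0 < r by exact: rising_gt0.
have cK : c <= K * (b - a) by rewrite -ler_pdivrMr// /K lerDr.
have : c * (r / N) <= K * (b - a) * (r / N) by rewrite ler_wpM2r// divr_ge0// ltW.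
have -> : K * (b - a) * (r / N) =
  K * ((1 + b / N) * r) - (1 + a / N) * (K * r) by field; rewrite gt_eqF.
by rewrite lerBrDl.
Qed.

(* The supersolution is [K * rising g n - L * rising b n]. *)
Lemma critical_growth g b c (u : nat -> R) : 0 <= b -> b < g -> 0 <= c ->
  (forall n, (0 < n)%N ->
    u n.+1 <= (1 + g / n%:R) * u n + c * (rising b n / n%:R)) ->
  exists2 K, 0 <= K & forall n, (0 < n)%N -> u n <= K * rising g n.
Proof.
move=> b0 bg c0 hu; have g0 : 0 <= g by lra.
have gb0 : 0 < g - b by lra.
pose L : R := c / (g - b).
have L0 : 0 <= L by rewrite divr_ge0// ltW.
pose K : R := `|u 1%N| + L.
have K0 : 0 <= K by rewrite addr_ge0.
suff H n : (0 < n)%N -> u n <= K * rising g n - L * rising b n.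
  exists K => // n n0; apply: (le_trans (H _ n0)).
  by rewrite lerBlDr lerDl mulr_ge0// ltW// rising_gt0.
elim: n => // -[_ _|n /(_ isT) IH _].
  by rewrite !rising1 !mulr1 /K addrK ler_norm.
apply: (le_trans (hu _ _)) => //.
rewrite (risingS g (ltn0Sn n)) (risingS b (ltn0Sn n)).
set r := rising g _ in IH *; set s := rising b _ in IH *; set N : R := n.+1%:R.
have N0 : 0 < N by rewrite ltr0n.
apply: (@le_trans _ _ ((1 + g / N) * (K * r - L * s) + c * (s / N))).
  by rewrite lerD2r ler_wpM2l// addr_ge0// divr_ge0// ltW.
have -> : c = L * (g - b) by rewrite /L divfK ?gt_eqF.
rewrite le_eqVlt; apply/predU1P; left; field; rewrite gt_eqF//.
Qed.

Lemma ln_succ_bounds n : (0 < n)%N ->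
  n.+1%:R^-1 <= ln n.+1%:R - ln n%:R :> R /\
  ln n.+1%:R - ln n%:R <= n%:R^-1 :> R.
Proof.
move=> n0; have N0 : 0 < n%:R :> R by rewrite ltr0n.
split; last first.
  rewrite -ln_div ?posrE ?ltr0n//.
  have -> : n.+1%:R / n%:R = 1 + n%:R^-1 :> R.
    by rewrite -natr1 mulrDl divff ?gt_eqF// mul1r.
  by apply: le_ln1Dx; rewrite (lt_le_trans (ltrN10 _)).
rewrite -opprB -ln_div ?posrE ?ltr0n// lerNr.
have -> : n%:R / n.+1%:R = 1 - n.+1%:R^-1 :> R.
  rewrite -natr1; move: (n%:R) N0 => x x0; field; lra.
by apply: le_ln1Dx; rewrite ltrN2 invf_lt1 ?ltr1n ?ltr0n.
Qed.

Lemma nbhs_ln_ge (A : R) : \forall n \near \oo, A <= ln n%:R.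
Proof.
near=> n; have eA : expR A <= n%:R by near: n; exact: nbhs_infty_ger.
have n0 : 0 < n%:R :> R by rewrite (lt_le_trans (expR_gt0 A)).
by rewrite -(expRK A) ler_ln ?posrE ?expR_gt0.
Unshelve. all: by end_near. Qed.

Lemma cvgn_inv_ln : (ln n%:R)^-1 @[n --> \oo] --> (0 : R).
Proof.
apply/gtr0_cvgV0; first by near=> n; rewrite ln_gt0// ltr1n; near: n; exists 2.
by apply/cvgryPge => A; exact: nbhs_ln_ge.
Unshelve. all: by end_near. Qed.

Lemma cvgn_rising_div q : 0 <= q -> q < 1 -> rising q n / n%:R @[n --> \oo] --> 0.
Proof.
move=> q0 q1.
(* Each step multiplies the ratio by [1 - (1 - q)/(n + 2)], at most [exp (- (1 - q)/(n + 2))]. As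
   [ln (n + 3) - ln (n + 2) <= 1/(n + 2)], the exponents telescope to a logarithm. *)
have H n : rising q n.+1 / n.+1%:R <= expR (- ((1 - q) * (ln n.+2%:R - ln 2))).
  elim: n => [|n IH]; first by rewrite rising1 subrr mulr0 oppr0 expR0 divr1.
  have -> : rising q n.+2 / n.+2%:R =
      (1 - (1 - q) / n.+2%:R) * (rising q n.+1 / n.+1%:R).
    rewrite (risingS q (ltn0Sn n)) -[n.+2%:R](@natr1 R) .
    by move: (n.+1%:R) (ltr0Sn R n) => x x0; field; rewrite !gt_eqF//; lra.
  have -> : - ((1 - q) * (ln n.+3%:R - ln 2)) =
    - ((1 - q) * (ln n.+3%:R - ln n.+2%:R)) + - ((1 - q) * (ln n.+2%:R - ln 2)) :> R.
    by ring.
  rewrite expRD; apply: ler_pM => //.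
  - have : (1 - q) / n.+2%:R <= 1 * 1.
      by apply: ler_pM; rewrite ?invr_ge0 ?invf_le1 ?ler1n//; lra.
    by rewrite mulr1 subr_ge0.
  - by rewrite divr_ge0// ltW// rising_gt0.
  - apply: (le_trans (expR_ge1Dx _)); rewrite ler_expR lerN2 ler_wpM2l//; first lra.
    by have [] := @ln_succ_bounds n.+2 isT.
rewrite -cvg_shiftS /=.
apply: (@squeeze_cvgr _ _ _ _ (fun=> 0) (fun n => expR (- ((1 - q) * (ln n.+2%:R - ln 2))))).
- by near=> n; rewrite H andbT divr_ge0// ltW// rising_gt0.
- exact: cvg_cst.
- apply: (@cvg_comp _ _ _ (fun n => (1 - q) * (ln n.+2%:R - ln 2))
    (fun x => expR (- x)) _ +oo).
    apply/cvgryPge => A; near=> n.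
    rewrite -ler_pdivrMl ?subr_gt0// lerBrDr.
    apply: (@le_trans _ _ (ln n%:R)); last first.
      have n0 : (0 < n)%N by near: n; exists 1%N.
      by rewrite ler_ln ?posrE ?ltr0n// ler_nat; lia.
    by near: n; exact: nbhs_ln_ge.
  exact: cvgr_expR.
Unshelve. all: by end_near. Qed.

Lemma subcritical_mean q c (s : nat -> R) : 0 <= q -> q < 1 ->
  (forall n, (0 < n)%N -> s n.+1 = (1 + q / n%:R) * s n + c) ->
  s n / n%:R @[n --> \oo] --> c / (1 - q).
Proof.
move=> q0 q1 hs; pose m : R := c / (1 - q).
have q1' : 1 - q != 0 by rewrite subr_eq0 gt_eqF.
(* [n m] is a particular solution because [m = q m + c]; the difference from it solves the
   homogeneous recursion. *)
have H n : (0 < n)%N -> s n = n%:R * m + (s 1%N - m) * rising q n.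
  elim: n => // -[_ _|n /(_ isT) IH _]; first by rewrite rising1; ring.
  rewrite hs// {}IH (risingS q (ltn0Sn n)) -[n.+2%:R](@natr1 R) /m.
  by move: (n.+1%:R) (ltr0Sn R n) => x x0; field; rewrite q1' gt_eqF.
suff : m + (s 1%N - m) * (rising q n / n%:R) @[n --> \oo] --> m + (s 1%N - m) * 0.
  rewrite mulr0 addr0; apply: cvg_trans; apply: near_eq_cvg; near=> n.
  have n0 : (0 < n)%N by near: n; exists 1%N.
  by rewrite [s n]H//; field; rewrite pnatr_eq0 -lt0n.
apply: cvgD; first exact: cvg_cst.
by apply: cvgMr; exact: cvgn_rising_div.
Unshelve. all: by end_near. Qed.

Lemma critical_mean c (s : nat -> R) :
  (forall n, (0 < n)%N -> s n.+1 = (1 + n%:R^-1) * s n + c) ->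
  s n / (n%:R * ln n%:R) @[n --> \oo] --> c.
Proof.
move=> hs.
(* After division by [n] the recursion reads [s (n+1)/(n+1) = s n / n + c/(n+1)]. Replacing
   [1/(n+1)] by the increment of [ln] costs at most [1/n - 1/(n+1)], which telescopes. *)
have H n : (0 < n)%N ->
    `|s n / n%:R - c * ln n%:R| <= `|s 1%N| + `|c| * (1 - n%:R^-1).
  elim: n => // -[_ _|n /(_ isT) IH _].
    by rewrite ln1 mulr0 subr0 invr1 subrr mulr0 addr0 mulr1.
  have -> : s n.+2 / n.+2%:R - c * ln n.+2%:R = (s n.+1 / n.+1%:R - c * ln n.+1%:R)
      + c * (n.+2%:R^-1 - (ln n.+2%:R - ln n.+1%:R)).
    rewrite hs// -[n.+2%:R](@natr1 R).
    by move: (n.+1%:R) (ltr0Sn R n) => x x0; field; rewrite !gt_eqF//; lra.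
  apply: (le_trans (ler_normD _ _)).
  have [l1 l2] := @ln_succ_bounds n.+1 isT.
  have : `|c * (n.+2%:R^-1 - (ln n.+2%:R - ln n.+1%:R))|
      <= `|c| * (n.+1%:R^-1 - n.+2%:R^-1).
    by rewrite normrM ler_wpM2l// distrC ger0_norm ?subr_ge0// lerD2r.
  by move: IH; rewrite !mulrBr; move: (n.+1%:R^-1) (n.+2%:R^-1) => i j; lra.
apply/cvgrPdist_le => e e0; near=> n.
have n1 : (1 < n)%N by near: n; exists 2.
have n0 : (0 < n)%N by exact: ltnW.
have l0 : 0 < ln n%:R :> R by rewrite ln_gt0// ltr1n.
have -> : c - s n / (n%:R * ln n%:R) = - ((s n / n%:R - c * ln n%:R) / ln n%:R).
  by field; rewrite pnatr_eq0 -lt0n n0 gt_eqF.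
rewrite normrN normrM normfV (ger0_norm (ltW l0)) ler_pdivrMr//.
apply: (le_trans (H _ n0)); apply: (@le_trans _ _ (`|s 1%N| + `|c|)).
  by rewrite lerD2l ler_piMr// lerBlDr lerDl invr_ge0.
by rewrite -ler_pdivrMl//; near: n; exact: nbhs_ln_ge.
Unshelve. all: by end_near. Qed.

End rising_products.

(** * Independence of the next variable from the past *)

Section independence.
Context (d : measure_display) (T : measurableType d) (R : realType).
Variable P : probability T R.

Lemma measurable_fun_mfun d' (T' : measurableType d') (f : T -> T') :
  measurable_fun setT f -> exists F : {mfun T >-> T'}, F = f :> (T -> T').
Proof.
by move=> mf; exists (HB.pack f (isMeasurableFun.Build _ _ _ _ _ mf) : {mfun T >-> T'}).
Qed.

Lemma ge0_integralM_indep (f g : T -> R) :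
  measurable_fun setT f -> measurable_fun setT g ->
  (forall w, 0 <= f w) -> (forall w, 0 <= g w) ->
  (forall A B, measurable A -> measurable B ->
    P (f @^-1` A `&` g @^-1` B) = (P (f @^-1` A) * P (g @^-1` B))%E) ->
  (\int[P]_w (f w * g w)%:E = \int[P]_w (f w)%:E * \int[P]_w (g w)%:E)%E.
Proof.
move=> mf mg f0 g0 fg.
have [H HE] : exists H : {mfun T >-> (R * R)%type}, H = (fun w => (f w, g w)) :> (T -> _).
  by apply: measurable_fun_mfun; exact: measurable_fun_pair.
have [F FE] := measurable_fun_mfun mf; have [G GE] := measurable_fun_mfun mg.
(* The absolute values make the integrand nonnegative on the whole plane, as Tonelli requires, and
   change nothing on the range of [(f, g)]. *)
pose k (z : R * R) : \bar R := (`|z.1| * `|z.2|)%:E.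
have mk : measurable_fun setT k.
  apply/measurable_EFinP; apply: measurable_funM.
    exact: (measurableT_comp (@normr_measurable R setT) measurable_fst).
  exact: (measurableT_comp (@normr_measurable R setT) measurable_snd).
pose n (x : R) : \bar R := `|x|%:E.
have n0 x : (0 <= n x)%E by rewrite lee_fin.
have mn : measurable_fun setT n.
  by apply/measurable_EFinP; exact: normr_measurable.
transitivity (\int[distribution P H]_z k z)%E.
  rewrite (@ge0_integral_distribution _ _ _ _ _ P H)//; last first.
    by move=> y; rewrite lee_fin mulr_ge0.
  by apply: eq_integral => w _ /=; rewrite /k HE/= !ger0_norm.
transitivity (\int[(distribution P F \x distribution P G)%E]_z k z)%E.
  apply: eq_measure_integral => A mA _; apply/esym.
  apply: product_measure_unique => // B C mB mC.
  by rewrite /= /distribution /pushforward HE FE GE; exact: fg.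
rewrite fubini_tonelli1//; last first.
  by move=> z; rewrite lee_fin mulr_ge0.
transitivity (\int[distribution P F]_x (n x * \int[distribution P G]_y n y))%E.
  apply: eq_integral => x _; rewrite /fubini_F/=.
  by rewrite {1}/n -ge0_integralZl_EFin.
rewrite ge0_integralZr//; last exact: integral_ge0.
rewrite (@ge0_integral_distribution _ _ _ _ _ P F)//.
rewrite (@ge0_integral_distribution _ _ _ _ _ P G)//.
by congr (_ * _)%E; apply: eq_integral => w _ /=; rewrite /n ?FE ?GE ger0_norm.
Qed.

Variable F : nat -> set (set T).
Hypothesis FT : forall k, F k setT.
Hypothesis FI : forall k, setI_closed (F k).
Hypothesis Fm : forall k, F k `<=` measurable.
Hypothesis F_indep : forall (n : nat) (E : nat -> set T),
  (forall k, F k (E k)) ->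
  P (\big[setI/setT]_(k < n) E k) = (\prod_(k < n) P (E k))%E.

(** Only a generating pi-system is recorded; the past sigma-algebra is [<<s past m >>]. Indexing the
    events by all of [nat] lets one sequence be patched at place [m] when the next event is
    adjoined. *)
Definition past (m : nat) : set (set T) :=
  [set A | exists2 E : nat -> set T, (forall k, F k (E k)) &
           A = \big[setI/setT]_(k < m) E k].

Lemma setI_closed_past m : setI_closed (past m).
Proof.
move=> _ _ [E FE ->] [E' FE' ->]; exists (fun k => E k `&` E' k).
  by move=> k; exact: FI.
by rewrite big_split.
Qed.

Lemma past_le m n : (m <= n)%N -> past m `<=` past n.
Proof.
move=> mn _ [E FE ->]; exists (fun k => if (k < m)%N then E k else setT).
  by move=> k; case: ifP.
by rewrite (big_ord_widen n E mn) big_mkcond.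
Qed.

Lemma sub_past k m : (k < m)%N -> F k `<=` past m.
Proof.
move=> km A FA; exists (fun i => if i == k then A else setT).
  by move=> i; case: eqP => // ->.
rewrite (bigD1 (Ordinal km))//= eqxx big1 ?setIT// => i.
by rewrite -val_eqE/= => /negbTE ->.
Qed.

Lemma past_measurable m : <<s past m >> `<=` measurable.
Proof.
apply: smallest_sub; first exact: sigma_algebra_measurable.
move=> _ [E FE ->]; elim/big_ind : _ => //=; first exact: measurableI.
by move=> k _; exact: Fm.
Qed.

(** Dynkin's argument with [B] fixed: the events independent of [B] are stable under complement and
    countable disjoint union, and they contain [past m] by the product rule with [B] put at place
    [m]. *)
Lemma indep_past m A B : <<s past m >> A -> F m B ->
  P (A `&` B) = (P A * P B)%E.
Proof.
move=> + FB; have mB := Fm FB.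
have Pfin C : measurable C -> P C \is a fin_num by move=> mC; exact: fin_num_measure.
have compl (S : set T) : measurable S ->
    P (S `&` B) = (P S * P B)%E -> P (~` S `&` B) = (P (~` S) * P B)%E.
  move=> mS SB; rewrite probability_setC// setIC -setDE measureD//; last first.
    by rewrite (le_lt_trans (probability_le1 _ _))// ltry.
  rewrite [X in (_ - X)%E](_ : _ = (P S * P B)%E); last by rewrite setIC; exact: SB.
  rewrite muleBl ?mul1e//; first by rewrite Pfin.

have union (E : (set T)^nat) : (forall n, measurable (E n)) -> trivIset setT E ->
    (forall n, P (E n `&` B) = (P (E n) * P B)%E) ->
    P (\bigcup_k E k `&` B) = (P (\bigcup_k E k) * P B)%E.
  move=> mE tE EB; rewrite setI_bigcupl.
  rewrite measure_bigcup//=; last 2 first.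
    by move=> k _; exact: measurableI.
    exact: trivIset_setIr.
  rewrite [in RHS]measure_bigcup//= muleC -{1}(fineK (Pfin B mB)) -nneseriesZl//.
  by apply: eq_eseriesr => k _; rewrite fineK ?Pfin// muleC; exact: EB.
apply: (@dynkin_induction _ (g_sigma_algebraType (past m)) (past m)
  [set A | P (A `&` B) = (P A * P B)%E]) => //=.
- exact: setI_closed_past.
- by rewrite setTI probability_setT mul1e.
- move=> _ [E FE ->].
  have := @F_indep m.+1 (fun k => if k == m then B else E k).
  rewrite !big_ord_recr/= !eqxx.
  rewrite (eq_bigr (fun k : 'I_m => E k)); last by move=> k _; rewrite ltn_eqF.
  rewrite (eq_bigr (fun k : 'I_m => P (E k))); last by move=> k _; rewrite ltn_eqF.
  by rewrite F_indep//; apply => k; case: eqP => // ->.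
- by move=> S /past_measurable; exact: compl.
- by move=> E mE; apply: union => k; exact: past_measurable (mE k).
Qed.

(** Retyping the domain as the generated measurable space makes the general closure lemmas for
    measurable functions apply verbatim to measurability with respect to the past. *)
Definition adapted (m : nat) (f : T -> R) : Prop :=
  measurable_fun (setT : set (g_sigma_algebraType (past m)))
    (f : g_sigma_algebraType (past m) -> R).

Lemma adapted_measurable m f : adapted m f -> measurable_fun setT f.
Proof. by move=> mf _ A mA; apply: (@past_measurable m); exact: mf. Qed.

Lemma adapted_le m n f : (m <= n)%N -> adapted m f -> adapted n f.
Proof.
move=> mn mf _ A mA; have := mf measurableT A mA; rewrite !setTI.
by apply: (@sub_sigma_algebra2 _ setT); exact: past_le.
Qed.

Lemma adapted_gen k m (f : T -> R) : (k < m)%N ->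
  (forall A, measurable A -> F k (f @^-1` A)) -> adapted m f.
Proof.
move=> km fF _ A mA; apply: sub_sigma_algebra.
by rewrite setTI; apply: (sub_past km); exact: fF.
Qed.

(** This takes the place of conditioning: a factor built from the newest variable is pulled out of
    an integral whose other factor is known from the past. *)
Lemma ge0_integralM_past m (f g : T -> R) :
  adapted m f -> (forall A, measurable A -> F m (g @^-1` A)) ->
  (forall w, 0 <= f w) -> (forall w, 0 <= g w) ->
  (\int[P]_w (f w * g w)%:E = \int[P]_w (f w)%:E * \int[P]_w (g w)%:E)%E.
Proof.
move=> mf gF f0 g0; apply: ge0_integralM_indep => //.
- exact: adapted_measurable mf.
- by move=> _ A mA; rewrite setTI; apply: Fm; exact: gF.
- move=> A B mA mB; apply: indep_past; last exact: gF.
  by have := mf measurableT A mA; rewrite setTI.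
Qed.

End independence.

(** * Choice of the moment exponent *)

Section moment_exponent.
Context {R : realType}.
Implicit Types h t x : R.

(** From [e^(-x) >= 1 - x] comes [e^x <= 1 + x e^x]. On the right, [e^x] is then bounded by the same
    inequality if [x >= 0], and by [e^x >= 1 + x] if [x < 0]. *)
Lemma expR_le_quad x : expR x <= 1 + x + x ^+ 2 * Num.max 1 (expR x).
Proof.
have e0 := expR_gt0 x.
have e1 : expR x <= 1 + x * expR x.
  have := expR_ge1Dx (- x); rewrite -(ler_pM2r e0) -expRD addNr expR0; lra.
case: (leP 0 x) => x0.
  rewrite max_r; last by rewrite -expR0 ler_expR.
  by nra.
rewrite max_l; last by rewrite -expR0 ler_expR ltW.
have := expR_ge1Dx x; nra.
Qed.

(** With [s = sqrt t] the left side is [4 (s ln s)^2], and [ln (1/s) <= 1/s] gives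
    [0 <= - s ln s <= 1]. *)
Lemma mul_ln_sqr_le4 t : 0 < t -> t <= 1 -> t * ln t ^+ 2 <= 4.
Proof.
move=> t0 t1; have s0 : 0 < t `^ 2^-1 by exact: powR_gt0.
have st : t = t `^ 2^-1 * t `^ 2^-1.
  rewrite -powRD ?(gt_eqF t0) ?implybT// (_ : 2^-1 + 2^-1 = 1); last by field.
  by rewrite powRr1// ltW.
have L0 : ln t <= 0 by exact: ln_le0.
have := ln_sublinear (_ : 0 < (t `^ 2^-1)^-1).
rewrite invr_gt0 s0 lnV ?posrE// ln_powR => /(_ isT) /ltW.
rewrite -(ler_pM2r s0) mulVf ?gt_eqF// => H.
have -> : t * ln t ^+ 2 = 4 * (- (2^-1 * ln t) * t `^ 2^-1) ^+ 2.
  by rewrite {1}st; field.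
rewrite -[leRHS]mulr1 ler_pM2l// expr_le1// mulr_ge0 ?(ltW s0)//; lra.
Qed.

(** Each logarithm costs a power [d] through [d ln t <= t^d], and [h] costs at most another [d]:
    this is the [3 d] by which [a] must exceed 1, and the reason for later taking [d] to be a third
    of [alpha - 1]. *)
Lemma mul_ln_sqr_le_powR (d h a t : R) : 0 < d -> h <= d -> 1 + 3 * d <= a -> 1 <= t ->
  t * t `^ h * ln t ^+ 2 <= d ^- 2 * t `^ a.
Proof.
move=> d0 hd da t1; have t0 : 0 < t by lra.
have tn0 : t != 0 by rewrite gt_eqF.
have L0 : 0 <= ln t by exact: ln_ge0.
have Ld : d * ln t <= t `^ d.
  by rewrite -ln_powR ltW// ln_sublinear// powR_gt0.
have td0 := powR_ge0 t d.
have L2 : ln t ^+ 2 <= d ^- 2 * (t `^ d * t `^ d).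
  rewrite ler_pdivlMl ?exprn_gt0//.
  by rewrite -exprMn expr2; apply: ler_pM => //; rewrite mulr_ge0// ltW.
apply: (@le_trans _ _ (t * t `^ h * (d ^- 2 * (t `^ d * t `^ d)))).
  by rewrite ler_wpM2l// mulr_ge0 ?powR_ge0// ltW.
rewrite mulrCA ler_wpM2l ?invr_ge0 ?exprn_ge0// ?(ltW d0)//.
rewrite -{1}(powRr1 (ltW t0)) -!powRD ?tn0 ?implybT//.
by rewrite ler_powR//; lra.
Qed.

Lemma mul_ln_sqr_le (d h a t : R) : 0 < d -> 0 <= h -> h <= d -> 1 + 3 * d <= a ->
  0 < t -> t * (ln t ^+ 2 * Num.max 1 (t `^ h)) <= (4 + d ^- 2) * (1 + t `^ a).
Proof.
move=> d0 h0 hd da t0.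
have ta0 := powR_ge0 t a.
have d20 : 0 < d ^- 2 by rewrite invr_gt0 exprn_gt0.
case: (leP t 1) => t1.
  rewrite max_l; last by rewrite -(powRr0 t) ger_powR// t0 t1.
  by have := mul_ln_sqr_le4 t0 t1; rewrite mulr1; nra.
rewrite max_r; last by rewrite -(powRr0 t) ler_powR// ltW.
by have := mul_ln_sqr_le_powR d0 hd da (ltW t1); rewrite mulrCA [ln t ^+ 2 * _]mulrC; nra.
Qed.

Lemma powR_taylor (d h a t : R) : 0 < d -> 0 < h -> h <= d -> 1 + 3 * d <= a -> 0 <= t ->
  t `^ (1 + h) <= t + h * (t * ln t) + h ^+ 2 * ((4 + d ^- 2) * (1 + t `^ a)).
Proof.
move=> d0 h0 hd da; rewrite le_eqVlt => /predU1P[<-|t0].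
  rewrite powR0 ?gt_eqF//; last by lra.
  rewrite !mul0r mulr0 !add0r mulr_ge0 ?sqr_ge0// mulr_ge0 ?addr_ge0 ?powR_ge0//.
  by rewrite invr_ge0 sqr_ge0.
have tn0 : t != 0 by rewrite gt_eqF.
have th : t `^ h = expR (h * ln t) by rewrite /powR (negbTE tn0).
rewrite powRD ?tn0 ?implybT// powRr1 ?(ltW t0)//.
have := expR_le_quad (h * ln t); rewrite -th -(ler_pM2l t0) => /le_trans; apply.
have := mul_ln_sqr_le d0 (ltW h0) hd da t0.
rewrite -(ler_pM2l (exprn_gt0 2 h0)) exprMn; nra.
Qed.

Lemma norm_mul_ln_le (d a t : R) : 0 < d -> 1 + 3 * d <= a -> 0 <= t ->
  `|t * ln t| <= (5 + d ^- 2) * (1 + t `^ a).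
Proof.
move=> d0 da; rewrite le_eqVlt => /predU1P[<-|t0].
  rewrite mul0r normr0 mulr_ge0 ?addr_ge0 ?powR_ge0//.
  by rewrite invr_ge0 sqr_ge0.
have := mul_ln_sqr_le d0 (lexx 0) (ltW d0) da t0; rewrite powRr0 maxxx mulr1.
have := ler_1DpowR (_ : 1 <= a) (ltW t0) => /(_ ltac:(lra)).
rewrite normrM (ger0_norm (ltW t0)) => H1 H2.
have : `|ln t| <= 1 + ln t ^+ 2.
  rewrite -(real_normK (num_real (ln t))); have := normr_ge0 (ln t).
  by move: `|ln t| => y; nra.
rewrite -(ler_pM2l t0); lra.
Qed.

Context (d : measure_display) (T : measurableType d) (P : probability T R).

Lemma integrable_le (f g : T -> R) : measurable_fun setT f ->
  (forall w, `|f w| <= g w) -> P.-integrable setT (EFin \o g) ->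
  P.-integrable setT (EFin \o f).
Proof.
move=> mf fg; apply: le_integrable => //; first exact/measurable_EFinP.
by move=> w _ /=; rewrite lee_fin (le_trans (fg w))// ler_norm.
Qed.

Lemma integrable_cst (c : R) : P.-integrable setT (EFin \o (fun=> c)).
Proof. exact: finite_measure_integrable_cst. Qed.

Lemma integrableDr (f g : T -> R) : P.-integrable setT (EFin \o f) ->
  P.-integrable setT (EFin \o g) -> P.-integrable setT (EFin \o (fun w => f w + g w)).
Proof. by move=> fi gi; exact: (integrableD measurableT fi gi). Qed.

Lemma integrableMlr (c : R) (f : T -> R) : P.-integrable setT (EFin \o f) ->
  P.-integrable setT (EFin \o (fun w => c * f w)).
Proof. by move=> fi; exact: (integrableZl measurableT c fi). Qed.

Lemma integrable_mul_ln (alpha : R) (xi : T -> R) :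
  1 < alpha -> measurable_fun setT xi -> (forall w, 0 <= xi w) ->
  P.-integrable setT (EFin \o (fun w => xi w `^ alpha)) ->
  P.-integrable setT (EFin \o (fun w => xi w * ln (xi w))).
Proof.
move=> a1 mxi xi0 ia.
pose dl : R := (alpha - 1) / 3.
have dl0 : 0 < dl by rewrite divr_gt0// subr_gt0.
have dla : 1 + 3 * dl <= alpha by rewrite /dl; lra.
apply: (integrable_le (g := fun w => (5 + dl ^- 2) * (1 + xi w `^ alpha))).
- by apply: measurable_funM => //; exact: (measurableT_comp (@measurable_ln R) mxi).
- by move=> w; exact: norm_mul_ln_le.
- by apply: integrableMlr; apply: integrableDr => //; exact: integrable_cst.
Qed.

(** Integrating [powR_taylor] gives [p m_(1+h) - (1+h) <= - (1 - p m_1) - h (1 - p e) + h^2 D],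
    where [e] is the integral of [xi ln xi]. For small [h] the constant term decides when
    [p m_1 < 1]; when [p m_1 = 1] it vanishes and the linear term decides, with
    [p e < p m_1 = 1]. *)
Lemma moment_exponent_exists (p alpha : R) (xi : T -> R) :
  0 < p -> 1 < alpha -> measurable_fun setT xi -> (forall w, 0 <= xi w) ->
  P.-integrable setT (EFin \o (fun w => xi w `^ alpha)) ->
  p * (\int[P]_w xi w) < 1 \/
  (p * (\int[P]_w xi w) = 1 /\ \int[P]_w (xi w * ln (xi w)) < \int[P]_w xi w) ->
  exists g : R, [/\ 1 < g, g <= 2, g <= alpha & p * (\int[P]_w (xi w `^ g)) < g].
Proof.
move=> p0 a1 mxi xi0 ia hyp.
pose dl : R := (alpha - 1) / 3.
have dl0 : 0 < dl by rewrite divr_gt0// subr_gt0.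
have dla : 1 + 3 * dl <= alpha by rewrite /dl; lra.
have i1a : P.-integrable setT (EFin \o (fun w => 1 + xi w `^ alpha)).
  by apply: integrableDr => //; exact: integrable_cst.
have mpow s : measurable_fun setT (fun w => xi w `^ s).
  exact: (measurableT_comp (measurable_powR s) mxi).
have ixi : P.-integrable setT (EFin \o xi).
  apply: (integrable_le mxi _ i1a) => w.
  by rewrite ger0_norm// ler_1DpowR// ltW.
have iln := integrable_mul_ln a1 mxi xi0 ia.
set m1 := \int[P]_w xi w in hyp *.
set e := \int[P]_w (xi w * ln (xi w)) in hyp *.
pose ma := \int[P]_w (1 + xi w `^ alpha).
have ma0 : 0 <= ma by apply: Rintegral_ge0 => w _; rewrite addr_ge0// powR_ge0.
pose C : R := 4 + dl ^- 2.
have C0 : 0 <= C by rewrite addr_ge0// invr_ge0 sqr_ge0.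
have bound h : 0 < h -> h <= dl ->
    \int[P]_w (xi w `^ (1 + h)) <= m1 + h * e + h ^+ 2 * (C * ma).
  move=> h0 hdl.
  have i2 : P.-integrable setT (EFin \o (fun w => C * (1 + xi w `^ alpha))).
    exact: integrableMlr.
  have -> : m1 + h * e + h ^+ 2 * (C * ma) = \int[P]_w (xi w + h * (xi w * ln (xi w))
      + h ^+ 2 * (C * (1 + xi w `^ alpha))).
    rewrite RintegralD//; last exact: integrableMlr; last first.
      by apply: integrableDr => //; exact: integrableMlr.
    rewrite RintegralD//; last exact: integrableMlr.
    by rewrite !RintegralZl.
  apply: le_Rintegral => //.
  - apply: (integrable_le _ _ i1a) => // w.
    by rewrite ger0_norm ?powR_ge0// ler_powR_1D//; lra.
  - by apply: integrableDr; [apply: integrableDr => //|]; exact: integrableMlr.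
  - by move=> w _; exact: powR_taylor.
pose D := p * (C * ma).
have D0 : 0 <= D by rewrite !mulr_ge0// ltW.
suff [h [h0 hdl h1 hD]] : exists h, [/\ 0 < h, h <= dl, h <= 1 &
    h ^+ 2 * D < (1 - p * m1) + h * (1 - p * e)].
  exists (1 + h); split; [lra|lra|lra|].
  by have := bound h h0 hdl; rewrite -(ler_pM2l p0) /D in hD *; nra.
case: hyp => [c0|[pm1 em1]].
  (* For [h <= 1] it is enough that [h (|p e| + D) < 1 - p m_1]; the factor 2 in the choice of [h]
     makes this strict. *)
  pose k : R := `|p * e| + D + 1.
  have k0 : 0 < k by rewrite /k ltr_wpDl// addr_ge0.
  have ck : 0 < (1 - p * m1) / (2 * k) by rewrite divr_gt0 ?subr_gt0// mulr_gt0.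
  exists (Num.min (Num.min dl 1) ((1 - p * m1) / (2 * k))).
  set h := Num.min _ _.
  have h0 : 0 < h by rewrite !lt_min dl0 ltr01.
  have hk : h * (2 * k) <= 1 - p * m1.
    by rewrite -ler_pdivlMr ?mulr_gt0// ge_min lexx orbT.
  have h1 : h <= 1 by rewrite !ge_min lexx orbT.
  split => //; first by rewrite !ge_min lexx.
  have := ler_norm (p * e); rewrite /k in hk; move: (normr_ge0 (p * e)) hk.
  move: `|p * e| (p * e) => x y; nra.
(* Without a constant term, division by [h] leaves the requirement [h D < 1 - p e]. *)
have pe1 : 0 < 1 - p * e by rewrite subr_gt0 -pm1 ltr_pM2l.
exists (Num.min (Num.min dl 1) ((1 - p * e) / (D + 1))).
set h := Num.min _ _.
have D1 : 0 < D + 1 by lra.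
have h0 : 0 < h by rewrite !lt_min dl0 ltr01 divr_gt0.
have hk : h * (D + 1) <= 1 - p * e by rewrite -ler_pdivlMr// ge_min lexx orbT.
split => //; [by rewrite !ge_min lexx|by rewrite !ge_min lexx orbT|].
rewrite pm1 subrr add0r expr2 -mulrA ltr_pM2l//; lra.
Qed.

End moment_exponent.

(** It turns the value at a random index into a finite sum of indicators times values at fixed
    indices, so that independence can be used term by term. *)
Lemma sum_eq_natr (R : realType) (n u : nat) (f : nat -> R) :
  \sum_(j < n) (u == j.+1)%:R * f j = if (0 < u <= n)%N then f u.-1 else 0.
Proof.
case: ifPn => [/andP[u0 un]|un].
  have un' : (u.-1 < n)%N by rewrite prednK.
  rewrite (bigD1 (Ordinal un'))//= prednK// eqxx mul1r big1 ?addr0// => j.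
  rewrite -val_eqE/= => ju; case: eqP => uj; last by rewrite mul0r.
  by rewrite uj eqxx in ju.
rewrite big1// => j _; case: eqP => uj; last by rewrite mul0r.
by rewrite uj ltn_ord in un.
Qed.

Lemma integral_bool (d : measure_display) (T : measurableType d) (R : realType)
    (P : {measure set T -> \bar R}) (A : set T) (b : T -> bool) :
  measurable A -> (forall w, A w <-> b w) -> (\int[P]_w ((b w)%:R)%:E = P A)%E.
Proof.
move=> mA Ab; transitivity (\int[P]_w (\1_A w)%:E)%E; last by rewrite integral_indic// setIT.
apply: eq_integral => w _; rewrite indicE; congr (_%:R)%:E; congr nat_of_bool.
by have [/Ab/mem_set|/negP bw] := boolP (b w) => //; apply/esym/memNset => /Ab.
Qed.

(** * The one-step identity for weighted powers of the walk's steps *)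

Section walk.
Context (d : measure_display) (T : measurableType d) (R : realType).
Variable P : probability T R.
Variables (p : R) (X xi : {RV P >-> R}).
Variables (Xs : nat -> {RV P >-> R}) (eps : nat -> {RV P >-> bool}).
Variables (U : nat -> {RV P >-> nat}) (xis : nat -> {RV P >-> R}).
Hypothesis p01 : 0 < p <= 1.
Hypothesis hwalk : is_rwes_data Xs eps U xis p X xi.
Hypothesis X_ge0 : forall w, 0 <= X w.
Hypothesis xi_ge0 : forall w, 0 <= xi w.
Hypothesis Xs_ge0 : forall n w, 0 <= Xs n w.
Hypothesis xis_ge0 : forall n w, 0 <= xis n w.

Local Notation step := (echo_step Xs eps U xis).
Local Notation walk := (echo_walk Xs eps U xis).

(* The order in which the walk uses its randomness: step [k + 1] depends on the
   first [4 k + 1] variables. *)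
Definition reveal (m : nat) : rwes_index :=
  match (m %% 4)%N with
  | 0 => Spin (m %/ 4).+1
  | 1 => Coin (m %/ 4).+2
  | 2 => Recall (m %/ 4).+2
  | _ => Echo (m %/ 4).+2
  end.

Lemma reveal_inj : injective reveal.
Proof.
move=> m n; rewrite /reveal => mn.
suff : (m %/ 4 = n %/ 4 /\ m %% 4 = n %% 4)%N.
  by move=> [a b]; rewrite (divn_eq m 4) (divn_eq n 4) a b.
move: mn (ltn_pmod m (isT : 0 < 4)%N) (ltn_pmod n (isT : 0 < 4)%N).
by case: (m %% 4)%N => [|[|[|[|?]]]]//; case: (n %% 4)%N => [|[|[|[|?]]]]// [->].
Qed.

Lemma reveal_domain m : rwes_domain (reveal m).
Proof. by rewrite /reveal; case: (m %% 4)%N => [|[|[|?]]]. Qed.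

Definition info (m : nat) : set (set T) := rwes_sigma Xs eps U xis (reveal m).

Lemma sigma_of_comp d' (T' : measurableType d') d'' (T'' : measurableType d'')
    (Y : {RV P >-> T'}) (f : T' -> T'') (A : set T'') :
  measurable_fun setT f -> measurable A -> sigma_of Y ((f \o Y) @^-1` A).
Proof.
move=> mf mA; exists (f @^-1` A); last by rewrite setTI.
by rewrite -[_ @^-1` _]setTI; exact: mf.
Qed.

Lemma sigma_of_setT d' (T' : measurableType d') (Y : {RV P >-> T'}) :
  sigma_of Y setT.
Proof. by exists setT => //; rewrite setTI preimage_setT. Qed.

Lemma sigma_of_setI d' (T' : measurableType d') (Y : {RV P >-> T'}) :
  setI_closed (sigma_of Y).
Proof.
move=> _ _ [A mA <-] [B mB <-]; exists (A `&` B); first exact: measurableI.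
by rewrite !setTI preimage_setI.
Qed.

Lemma sigma_of_measurable d' (T' : measurableType d') (Y : {RV P >-> T'}) :
  sigma_of Y `<=` measurable.
Proof. by move=> _ [A mA <-]; rewrite setTI; exact: measurable_funPTI. Qed.

Lemma info_setT m : info m setT.
Proof. by rewrite /info; case: (reveal m) => n; exact: sigma_of_setT. Qed.

Lemma info_setI m : setI_closed (info m).
Proof. by rewrite /info; case: (reveal m) => n; exact: sigma_of_setI. Qed.

Lemma info_measurable m : info m `<=` measurable.
Proof. by rewrite /info; case: (reveal m) => n; exact: sigma_of_measurable. Qed.

Lemma info_indep n (E : nat -> set T) : (forall k, info k (E k)) ->
  P (\big[setI/setT]_(k < n) E k) = (\prod_(k < n) P (E k))%E.
Proof.
move=> IE; have := rwes_indep hwalk; apply: (_ : mutually_independent _ _ _ -> _).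
move=> /(_ n (fun k => reveal k) (fun k => E k)); apply => //.
- by move=> i j /reveal_inj /val_inj.
- by move=> k; exact: reveal_domain.
- by move=> k; exact: IE.
Qed.

Lemma info_spin k (f : R -> R) A : measurable_fun setT f -> measurable A ->
  info (4 * k) ((fun w => f (Xs k.+1 w)) @^-1` A).
Proof.
by move=> mf mA; rewrite /info /reveal modnMr mulKn//; exact: sigma_of_comp.
Qed.

Lemma info_coin k (f : bool -> R) A : measurable A ->
  info (4 * k).+1 ((fun w => f (eps k.+2 w)) @^-1` A).
Proof.
move=> mA; rewrite /info /reveal -addn1 mulnC modnMDl divnMDl//= addn0.
exact: (@sigma_of_comp _ _ _ _ _ f).
Qed.

Lemma info_recall k (f : nat -> R) A : measurable A ->
  info (4 * k).+2 ((fun w => f (U k.+2 w)) @^-1` A).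
Proof.
move=> mA; rewrite /info /reveal -addn2 mulnC modnMDl divnMDl//= addn0.
exact: (@sigma_of_comp _ _ _ _ _ f).
Qed.

Lemma info_echo k (f : R -> R) A : measurable_fun setT f -> measurable A ->
  info (4 * k).+3 ((fun w => f (xis k.+2 w)) @^-1` A).
Proof.
move=> mf mA; rewrite /info /reveal -addn3 mulnC modnMDl divnMDl//= addn0.
exact: sigma_of_comp.
Qed.

Local Notation adapted := (@adapted d T R info).

(** It holds at every [w], without excluding a null set: a recall of 0 reads the dummy entry of the
    table, a recall that is too large reads the default of [nth], and in both cases the sum is 0
    too. *)
Lemma echo_step_rec k w : step k.+2 w = (1 - (eps k.+2 w)%:R) * Xs k.+2 w
  + (eps k.+2 w)%:R * xis k.+2 w * \sum_(j < k.+1) (U k.+2 w == j.+1)%:R * step j.+1 w.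
Proof.
rewrite {1}/echo_step [echo_table _ _ _ _ k.+2 w]/= -/(echo_table _ _ _ _ k.+1 w).
rewrite nth_rcons size_echo_table ltnn eqxx; congr (_ + _ * _).
rewrite (sum_eq_natr k.+1 (U k.+2 w) (fun j => step j.+1 w)).
case: ifPn => [/andP[u0 uk]|]; first by rewrite prednK// nth_echo_table.
rewrite negb_and -leqNgt leqn0 -ltnNge => /orP[/eqP ->|uk].
  by rewrite nth_echo_table.
by rewrite nth_default// size_echo_table.
Qed.

Lemma step_ge0 k w : 0 <= step k.+1 w.
Proof.
elim/ltn_ind: k => -[_|k IH]; first by rewrite echo_step1.
rewrite echo_step_rec addr_ge0// mulr_ge0//.
- by case: (eps _ _); rewrite ?subrr ?subr0.
- by rewrite mulr_ge0.
- by apply: sumr_ge0 => j _; rewrite mulr_ge0// IH.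
Qed.

Lemma walkS k w : walk k.+1 w = walk k w + step k.+1 w.
Proof. by rewrite /echo_walk big_nat_recr. Qed.

Lemma walkE k w : walk k.+1 w = \sum_(j < k.+1) step j.+1 w.
Proof. by rewrite /echo_walk big_add1 big_mkord. Qed.

Lemma walk_ge0 k w : 0 <= walk k w.
Proof.
case: k => [|k]; first by rewrite /echo_walk big_geq.
by rewrite walkE; apply: sumr_ge0 => j _; exact: step_ge0.
Qed.

Lemma walk_homo w : {homo (fun n => walk n w) : m n / (m <= n)%N >-> m <= n}.
Proof.
apply: homo_leq => [//|y x z|k]; first exact: le_trans.
by rewrite walkS lerDl step_ge0.
Qed.

(** At each [w] at most one of the summands of [echo_step_rec] survives, so the power passes through
    the sum; [s > 0] is what makes the zero terms stay zero. *)
Lemma step_powR (s : R) k w : 0 < s -> step k.+2 w `^ s =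
  (1 - (eps k.+2 w)%:R) * Xs k.+2 w `^ s
  + \sum_(j < k.+1) step j.+1 w `^ s * (eps k.+2 w)%:R * (U k.+2 w == j.+1)%:R
      * xis k.+2 w `^ s.
Proof.
move=> s0; have sn0 : s != 0 by rewrite gt_eqF.
have -> : \sum_(j < k.+1) step j.+1 w `^ s * (eps k.+2 w)%:R * (U k.+2 w == j.+1)%:R
      * xis k.+2 w `^ s = (eps k.+2 w)%:R * xis k.+2 w `^ s *
    \sum_(j < k.+1) (U k.+2 w == j.+1)%:R * step j.+1 w `^ s.
  by rewrite mulr_sumr; apply: eq_bigr => j _; ring.
rewrite echo_step_rec (sum_eq_natr k.+1 (U k.+2 w) (fun j => step j.+1 w)).
rewrite (sum_eq_natr k.+1 (U k.+2 w) (fun j => step j.+1 w `^ s)).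
case: (eps k.+2 w); rewrite ?subrr ?subr0 ?mul0r ?mul1r ?add0r ?addr0//.
case: ifP => _; first by rewrite powRM// step_ge0.
by rewrite !mulr0 powR0.
Qed.

Lemma adapted_step k : adapted (4 * k).+1 (step k.+1).
Proof.
clear p01; have le := @adapted_le d T R info info_setT.
elim/ltn_ind: k => -[_|k IH].
  apply: (adapted_gen info_setT (k := (4 * 0)%N)) => // A mA.
  exact: (@info_spin 0 id).
rewrite (_ : step k.+2 = fun w => (1 - (eps k.+2 w)%:R) * Xs k.+2 w
  + (eps k.+2 w)%:R * xis k.+2 w * \sum_(j < k.+1) (U k.+2 w == j.+1)%:R * step j.+1 w);
  last by apply/funext => w; exact: echo_step_rec.
have ae (f : bool -> R) : adapted (4 * k.+1).+1 (fun w => f (eps k.+2 w)).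
  apply: (adapted_gen info_setT (k := (4 * k).+1)); first by lia.
  by move=> A mA; exact: info_coin.
have aX : adapted (4 * k.+1).+1 (Xs k.+2).
  apply: (adapted_gen info_setT (k := (4 * k.+1)%N)); first by lia.
  by move=> A mA; exact: (@info_spin k.+1 id).
have axi : adapted (4 * k.+1).+1 (xis k.+2).
  apply: (adapted_gen info_setT (k := (4 * k).+3)); first by lia.
  by move=> A mA; exact: (@info_echo k id).
have aU (f : nat -> R) : adapted (4 * k.+1).+1 (fun w => f (U k.+2 w)).
  apply: (adapted_gen info_setT (k := (4 * k).+2)); first by lia.
  by move=> A mA; exact: info_recall.
apply: measurable_funD.
  by apply: measurable_funM => //; exact: (ae (fun b => 1 - b%:R)).
apply: measurable_funM.
  by apply: measurable_funM => //; exact: (ae (fun b => b%:R)).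
apply: measurable_sum => j; apply: measurable_funM.
  exact: (aU (fun u => (u == j.+1)%:R)).
have jk := ltn_ord j.
by apply: (le (4 * j).+1); [lia|exact: IH].
Qed.

Lemma adapted_powR m f s : adapted m f -> adapted m (fun w => f w `^ s).
Proof. by move=> mf; exact: (measurableT_comp (measurable_powR s) mf). Qed.

Lemma same_law_integral (Y Z : {RV P >-> R}) (f : R -> R) : same_law Y Z ->
  measurable_fun setT f -> (forall x, 0 <= f x) ->
  (\int[P]_w (f (Y w))%:E = \int[P]_w (f (Z w))%:E)%E.
Proof.
move=> YZ mf f0; have mf' : measurable_fun setT (EFin \o f) by exact/measurable_EFinP.
have f0' x : (0 <= (EFin \o f) x)%E by rewrite lee_fin.
rewrite -[LHS](ge0_integral_distribution Y mf' f0').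
rewrite -[RHS](ge0_integral_distribution Z mf' f0').
by apply: eq_measure_integral => A mA _; exact: YZ.
Qed.

Lemma coin_law k b :
  P (eps k.+2 @^-1` [set b]) = (if b then p else 1 - p)%:E.
Proof.
have := rwes_coin hwalk (isT : (1 < k.+2)%N) [set b].
rewrite /distribution /pushforward => ->; rewrite /bernoulli_prob.
by case/andP: p01 => /ltW -> -> /=; rewrite fsbig_set1/= /bernoulli_pmf; case: b.
Qed.

Lemma integral_coin k (b : bool) :
  (\int[P]_w ((eps k.+2 w == b)%:R)%:E = (if b then p else 1 - p)%:E)%E.
Proof.
rewrite -(coin_law k b); apply: integral_bool; first exact: measurable_funPTI.
by move=> w; split=> /eqP.
Qed.

Lemma integral_recall k (j : 'I_k.+1) :
  (\int[P]_w ((U k.+2 w == j.+1)%:R)%:E = (k.+1%:R^-1)%:E)%E.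
Proof.
have := rwes_recall hwalk (isT : (1 < k.+2)%N) j.+1.
rewrite /= ltnS ltn_ord => <-; rewrite /distribution /pushforward.
apply: integral_bool; first exact: measurable_funPTI.
by move=> w; split=> /eqP.
Qed.

Lemma integralM_info m (f g : T -> R) :
  adapted m f -> (forall A, measurable A -> info m (g @^-1` A)) ->
  (forall w, 0 <= f w) -> (forall w, 0 <= g w) ->
  (\int[P]_w (f w * g w)%:E = \int[P]_w (f w)%:E * \int[P]_w (g w)%:E)%E.
Proof.
exact: (ge0_integralM_past info_setI info_measurable info_indep).
Qed.

Lemma adapted_info_measurable m f : adapted m f -> measurable_fun setT f.
Proof. exact: (adapted_measurable info_measurable). Qed.

(** The conditional expectation of [step^s] given the past, tested against an adapted weight.
    Working with nonnegative extended integrals lets it hold before any integrability is known;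
    finiteness of step moments is then deduced from it by induction. *)
Lemma integral_mul_step (s : R) k (F : T -> R) :
  0 < s -> adapted (4 * k).+1 F -> (forall w, 0 <= F w) ->
  (\int[P]_w (F w * step k.+2 w `^ s)%:E =
    \int[P]_w (F w)%:E * (1 - p)%:E * \int[P]_w (X w `^ s)%:E
    + \sum_(j < k.+1) \int[P]_w (F w * step j.+1 w `^ s)%:E
        * p%:E * (k.+1%:R^-1)%:E * \int[P]_w (xi w `^ s)%:E)%E.
Proof.
move=> s0 aF F0.
have le := @adapted_le d T R info info_setT.
have aF' m : ((4 * k).+1 <= m)%N -> adapted m F by move=> /le; exact.
have ae m b : ((4 * k).+1 < m)%N -> adapted m (fun w => (eps k.+2 w == b)%:R).
  move=> km; apply: (adapted_gen info_setT km) => A mA.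
  exact: (@info_coin k (fun e => (e == b)%:R)).
have aU m j : ((4 * k).+2 < m)%N -> adapted m (fun w => (U k.+2 w == j)%:R).
  move=> km; apply: (adapted_gen info_setT km) => A mA.
  exact: (@info_recall k (fun u => (u == j)%:R)).
have aS m (j : 'I_k.+1) : ((4 * k).+1 <= m)%N -> adapted m (fun w => step j.+1 w `^ s).
  move=> km; apply: (@le (4 * j).+1); first by have := ltn_ord j; lia.
  by apply: adapted_powR; exact: adapted_step.
have aX : adapted (4 * k.+1).+1 (fun w => Xs k.+2 w `^ s).
  apply: (adapted_gen info_setT (k := (4 * k.+1)%N)); first by lia.
  by move=> A mA; apply: (@info_spin k.+1 (fun x => x `^ s)).
have axi : adapted (4 * k.+1).+1 (fun w => xis k.+2 w `^ s).
  apply: (adapted_gen info_setT (k := (4 * k).+3)); first by lia.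
  by move=> A mA; apply: (@info_echo k (fun x => x `^ s)).
(* The new variables are peeled off in the reverse of the order of [reveal]: spin then coin in the
   fresh term, echo, recall, then coin in each echoed term. *)
pose f0 w := F w * (eps k.+2 w == false)%:R.
pose f (j : 'I_k.+1) w := F w * step j.+1 w `^ s * (eps k.+2 w == true)%:R
  * (U k.+2 w == j.+1)%:R.
have f0_ge0 w : 0 <= f0 w by rewrite mulr_ge0.
have f_ge0 j w : 0 <= f j w by rewrite !mulr_ge0// powR_ge0.
have af0 m : ((4 * k).+1 < m)%N -> adapted m f0.
  by move=> km; apply: measurable_funM; [apply: aF'; lia|exact: ae].
have af m j : ((4 * k).+2 < m)%N -> adapted m (f j).
  move=> km; apply: measurable_funM; last exact: aU.
  apply: measurable_funM; last by apply: ae; lia.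
  by apply: measurable_funM; [apply: aF'; lia|apply: aS; lia].
transitivity (\int[P]_w ((f0 w * Xs k.+2 w `^ s)%:E
    + \sum_(j < k.+1) (f j w * xis k.+2 w `^ s)%:E))%E.
  apply: eq_integral => w _; rewrite sumEFin -EFinD; congr EFin.
  rewrite step_powR// mulrDr mulr_sumr /f0 /f; congr (_ + _).
    by case: (eps _ _) => /=; rewrite ?subrr ?subr0; ring.
  by apply: eq_bigr => j _; case: (eps _ _) => /=; ring.
have mf0 : measurable_fun setT (fun w => (f0 w * Xs k.+2 w `^ s)%:E).
  apply/measurable_EFinP/(@adapted_info_measurable (4 * k.+1).+1).
  by apply: measurable_funM => //; apply: af0; lia.
have mf j : measurable_fun setT (fun w => (f j w * xis k.+2 w `^ s)%:E).
  apply/measurable_EFinP/(@adapted_info_measurable (4 * k.+1).+1).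
  by apply: measurable_funM => //; apply: af; lia.
rewrite ge0_integralD//; last 3 first.
  - by move=> w _; rewrite lee_fin mulr_ge0// powR_ge0.
  - by move=> w _; apply: sume_ge0 => j _; rewrite lee_fin mulr_ge0// powR_ge0.
  - by apply: emeasurable_sum => j.
rewrite ge0_integral_sum//; last by move=> j w _; rewrite lee_fin mulr_ge0// powR_ge0.
congr (_ + _)%E.
  rewrite (@integralM_info (4 * k.+1)%N f0 (fun w => Xs k.+2 w `^ s))//; last 3 first.
  - by apply: af0; lia.
  - by move=> A mA; apply: (@info_spin k.+1 (fun x => x `^ s)).
  - by move=> w; exact: powR_ge0.
  rewrite (same_law_integral (f := fun x => x `^ s)
    (rwes_spin hwalk (isT : (0 < k.+2)%N)))//; last first.
    by move=> x; exact: powR_ge0.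
  rewrite (@integralM_info (4 * k).+1 F (fun w => (eps k.+2 w == false)%:R))//; last first.
    by move=> A mA; exact: (@info_coin k (fun e => (e == false)%:R)).
  by rewrite (integral_coin k false).
apply: eq_bigr => j _.
rewrite (@integralM_info (4 * k).+3 (f j) (fun w => xis k.+2 w `^ s))//; last 3 first.
- exact: af.
- by move=> A mA; apply: (@info_echo k (fun x => x `^ s)).
- by move=> w; exact: powR_ge0.
rewrite (same_law_integral (f := fun x => x `^ s)
  (rwes_echo hwalk (isT : (1 < k.+2)%N)))//; last first.
  by move=> x; exact: powR_ge0.
rewrite (@integralM_info (4 * k).+2
  (fun w => F w * step j.+1 w `^ s * (eps k.+2 w == true)%:R)
  (fun w => (U k.+2 w == j.+1)%:R))//; last 3 first.
- apply: measurable_funM; last exact: ae.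
  by apply: measurable_funM; [exact: aF'|exact: aS].
- by move=> A mA; exact: (@info_recall k (fun u => (u == j.+1)%:R)).
- by move=> w; rewrite !mulr_ge0// powR_ge0.
rewrite integral_recall (@integralM_info (4 * k).+1
  (fun w => F w * step j.+1 w `^ s) (fun w => (eps k.+2 w == true)%:R))//; last 3 first.
- by apply: measurable_funM; [exact: aF'|exact: aS].
- by move=> A mA; exact: (@info_coin k (fun e => (e == true)%:R)).
- by move=> w; rewrite !mulr_ge0// powR_ge0.
by rewrite (integral_coin k true).
Qed.

End walk.

Section integrability.
Context (d : measure_display) (T : measurableType d) (R : realType).
Variable P : probability T R.
Implicit Types f g : T -> R.

Lemma EFin_Rintegral f : P.-integrable setT (EFin \o f) ->
  (\int[P]_w (f w)%:E)%E = (\int[P]_w f w)%:E.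
Proof. by move=> fi; rewrite /Rintegral fineK//; exact: integrable_fin_num. Qed.

Lemma ge0_integrable f : measurable_fun setT f -> (forall w, 0 <= f w) ->
  (\int[P]_w (f w)%:E < +oo)%E -> P.-integrable setT (EFin \o f).
Proof.
move=> mf f0 fi; apply/integrableP; split; first exact/measurable_EFinP.
by under eq_integral do rewrite /= ger0_norm//.
Qed.

Lemma integrable_measurable f : P.-integrable setT (EFin \o f) -> measurable_fun setT f.
Proof. by move=> /measurable_int /measurable_EFinP. Qed.

Lemma integrable_sumr (I : Type) (s : seq I) (h : I -> T -> R) :
  (forall i, P.-integrable setT (EFin \o h i)) ->
  P.-integrable setT (EFin \o (fun w => \sum_(i <- s) h i w)).
Proof.
move=> hi; elim: s => [|i s IH].
  rewrite (_ : (fun w => _) = fun=> 0); first exact: integrable_cst.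
  by apply/funext => w; rewrite big_nil.
rewrite (_ : (fun w => _) = fun w => h i w + \sum_(i <- s) h i w).
  exact: integrableDr.
by apply/funext => w; rewrite big_cons.
Qed.

Lemma Rintegral_sum (I : Type) (s : seq I) (h : I -> T -> R) :
  (forall i, P.-integrable setT (EFin \o h i)) ->
  \int[P]_w (\sum_(i <- s) h i w) = \sum_(i <- s) \int[P]_w h i w.
Proof.
move=> hi; elim: s => [|i s IH].
  rewrite big_nil -[RHS](mul0r (fine (P setT))) -Rintegral_cst//.
  by apply: eq_Rintegral => w _; rewrite big_nil.
rewrite big_cons -IH -RintegralD//; last exact: integrable_sumr.
by apply: eq_Rintegral => w _; rewrite big_cons.
Qed.

Lemma Rintegral_cst1 (c : R) : \int[P]_w c = c.
Proof.
rewrite Rintegral_cst//.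
exact: etrans (congr1 (fun x => c * fine x) (probability_setT P)) (mulr1 c).
Qed.

End integrability.

(** * Moments of the steps *)

Section moments.
Context (d : measure_display) (T : measurableType d) (R : realType).
Variable P : probability T R.
Variables (p : R) (X xi : {RV P >-> R}).
Variables (Xs : nat -> {RV P >-> R}) (eps : nat -> {RV P >-> bool}).
Variables (U : nat -> {RV P >-> nat}) (xis : nat -> {RV P >-> R}).
Hypothesis p01 : 0 < p <= 1.
Hypothesis hwalk : is_rwes_data Xs eps U xis p X xi.
Hypothesis X_ge0 : forall w, 0 <= X w.
Hypothesis xi_ge0 : forall w, 0 <= xi w.
Hypothesis Xs_ge0 : forall n w, 0 <= Xs n w.
Hypothesis xis_ge0 : forall n w, 0 <= xis n w.

Local Notation step := (echo_step Xs eps U xis).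
Local Notation walk := (echo_walk Xs eps U xis).
Local Notation info := (info Xs eps U xis).
Local Notation adapted := (@adapted d T R info).
Local Notation integrable f := (P.-integrable setT (EFin \o f)).

Definition spin_moment (s : R) : R := \int[P]_w (X w `^ s).
Definition echo_moment (s : R) : R := \int[P]_w (xi w `^ s).
Definition step_moment (s : R) (k : nat) : R := \int[P]_w (step k.+1 w `^ s).
Definition step_moment_sum (s : R) (n : nat) : R := \sum_(j < n) step_moment s j.

Lemma p_ge0 : 0 <= p. Proof. by case/andP: p01 => /ltW. Qed.
Lemma onem_p_ge0 : 0 <= 1 - p. Proof. by case/andP: p01; rewrite subr_ge0. Qed.

Lemma spin_moment_ge0 s : 0 <= spin_moment s.
Proof. by apply: Rintegral_ge0 => w _; exact: powR_ge0. Qed.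

Lemma echo_moment_ge0 s : 0 <= echo_moment s.
Proof. by apply: Rintegral_ge0 => w _; exact: powR_ge0. Qed.

Lemma step_moment_ge0 s k : 0 <= step_moment s k.
Proof. by apply: Rintegral_ge0 => w _; exact: powR_ge0. Qed.

Lemma measurable_step k : measurable_fun setT (step k.+1).
Proof. exact: (adapted_info_measurable (@adapted_step _ _ _ _ Xs eps U xis k)). Qed.

Lemma measurable_walk k : measurable_fun setT (walk k).
Proof.
case: k => [|k].
  rewrite (_ : walk 0 = cst 0); first exact: measurable_cst.
  by apply/funext => w; rewrite /echo_walk big_geq.
rewrite (_ : walk k.+1 = fun w => \sum_(j < k.+1) step j.+1 w).
  by apply: measurable_sum => j; exact: measurable_step.
by apply/funext => w; rewrite walkE.
Qed.

Lemma adapted_walk k : adapted (4 * k).+1 (walk k.+1).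
Proof.
clear p01.
rewrite (_ : walk k.+1 = fun w => \sum_(j < k.+1) step j.+1 w).
  apply: measurable_sum => j; have jk := ltn_ord j.
  apply: (@adapted_le _ _ _ info (info_setT _ _ _ _) (4 * j).+1); first by lia.
  exact: (@adapted_step _ _ _ _ Xs eps U xis j).
by apply/funext => w; rewrite walkE.
Qed.

Lemma measurable_step_powR s k : measurable_fun setT (fun w => step k.+1 w `^ s).
Proof. by apply: (measurableT_comp (measurable_powR s)); exact: measurable_step. Qed.

Lemma mul_step_moment (s : R) k (F : T -> R) :
  0 < s -> adapted (4 * k).+1 F -> (forall w, 0 <= F w) ->
  integrable (fun w => X w `^ s) -> integrable (fun w => xi w `^ s) ->
  integrable F ->
  (forall j : 'I_k.+1, integrable (fun w => F w * step j.+1 w `^ s)) ->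
  integrable (fun w => F w * step k.+2 w `^ s) /\
  \int[P]_w (F w * step k.+2 w `^ s) =
    (1 - p) * spin_moment s * \int[P]_w F w +
    p * echo_moment s / k.+1%:R
      * \sum_(j < k.+1) \int[P]_w (F w * step j.+1 w `^ s).
Proof.
move=> s0 aF F0 iX ixi iF iFs.
have E := integral_mul_step p01 hwalk Xs_ge0 xis_ge0 s0 aF F0.
have {}E : (\int[P]_w (F w * step k.+2 w `^ s)%:E)%E =
    ((1 - p) * spin_moment s * (\int[P]_w F w) +
    p * echo_moment s / k.+1%:R
      * \sum_(j < k.+1) \int[P]_w (F w * step j.+1 w `^ s))%:E.
  rewrite E (EFin_Rintegral iF) (EFin_Rintegral iX) (EFin_Rintegral ixi).
  under eq_bigr => j _ do rewrite (EFin_Rintegral (iFs j)) -!EFinM.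
  rewrite sumEFin -!EFinM -EFinD; congr EFin.
  rewrite /spin_moment /echo_moment mulr_sumr; congr (_ + _); first by ring.
  by apply: eq_bigr => j _; ring.
split; last by rewrite /Rintegral E.
apply: ge0_integrable; last by rewrite E ltry.
  apply: measurable_funM; last exact: measurable_step_powR.
  exact: (integrable_measurable iF).
by move=> w; rewrite mulr_ge0// powR_ge0.
Qed.

Lemma adapted_cst m (c : R) : adapted m (fun=> c).
Proof. exact: measurable_cst. Qed.

Lemma integrable_step_powR s k : 0 < s ->
  integrable (fun w => X w `^ s) -> integrable (fun w => xi w `^ s) ->
  integrable (fun w => step k.+1 w `^ s).
Proof.
move=> s0 iX ixi; elim/ltn_ind: k => -[_|k IH].
  apply: ge0_integrable; first exact: measurable_step_powR.
    by move=> w; exact: powR_ge0.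
  rewrite (same_law_integral (Y := Xs 1) (Z := X) (f := fun x => x `^ s))//.
  - by rewrite (EFin_Rintegral iX) ltry.
  - exact: (rwes_spin hwalk).
  - by move=> x; exact: powR_ge0.
have [] := @mul_step_moment s k (fun=> 1) s0 (@adapted_cst _ _) (fun=> ler01) iX ixi.
- exact: integrable_cst.
- by move=> j; under eq_fun do rewrite mul1r; exact: IH.
- by move=> + _; under eq_fun do rewrite mul1r.
Qed.

Lemma step_momentS s k : 0 < s ->
  integrable (fun w => X w `^ s) -> integrable (fun w => xi w `^ s) ->
  step_moment s k.+1 = (1 - p) * spin_moment s
    + p * echo_moment s / k.+1%:R * step_moment_sum s k.+1.
Proof.
move=> s0 iX ixi.
have [] := @mul_step_moment s k (fun=> 1) s0 (@adapted_cst _ _) (fun=> ler01) iX ixi.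
- exact: integrable_cst.
- by move=> j; under eq_fun do rewrite mul1r; exact: integrable_step_powR.
move=> _; rewrite (Rintegral_cst1 P 1) mulr1.
under [in X in X = _ -> _]eq_Rintegral do rewrite mul1r.
rewrite -/(step_moment s k.+1) => ->; congr (_ + _ * _); apply: eq_bigr => j _.
by apply: eq_Rintegral => w _; rewrite mul1r.
Qed.

Lemma step_moment_sumS s n : (0 < n)%N -> 0 < s ->
  integrable (fun w => X w `^ s) -> integrable (fun w => xi w `^ s) ->
  step_moment_sum s n.+1 =
    (1 + p * echo_moment s / n%:R) * step_moment_sum s n + (1 - p) * spin_moment s.
Proof.
case: n => // n _ s0 iX ixi; rewrite {1}/step_moment_sum big_ord_recr/=.
by rewrite step_momentS// -/(step_moment_sum s n.+1); ring.
Qed.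

(** The summed moments satisfy a recursion of rate [p m_s] with constant source, and [b >= 1] gives
    [1 <= rising b n / n], so [subcritical_growth] applies. The bound on the sum then re-enters the
    formula for a single moment, where it is divided by the index. *)
Lemma step_moment_bound s b : 0 < s -> 1 <= b -> p * echo_moment s < b ->
  integrable (fun w => X w `^ s) -> integrable (fun w => xi w `^ s) ->
  exists2 K, 0 <= K & forall k, step_moment s k.+1 <= K * (rising b k.+1 / k.+1%:R).
Proof.
move=> s0 b1 mb iX ixi; have c0 : 0 <= (1 - p) * spin_moment s.
  by rewrite mulr_ge0 ?onem_p_ge0 ?spin_moment_ge0.
have r0 : 0 <= p * echo_moment s by rewrite mulr_ge0 ?p_ge0 ?echo_moment_ge0.
have src n : (0 < n)%N -> (1 - p) * spin_moment s <=
    (1 - p) * spin_moment s * (rising b n / n%:R).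
  move=> n0; rewrite ler_peMr// ler_pdivlMr ?ltr0n// mul1r; exact: rising_ge_n.
have [n n0|K K0 HK] := @subcritical_growth R _ b _ (step_moment_sum s) r0 mb c0.
  by rewrite step_moment_sumS// lerD2l; exact: src.
exists ((1 - p) * spin_moment s + p * echo_moment s * K).
  by rewrite addr_ge0// mulr_ge0.
move=> k; rewrite step_momentS// [leRHS]mulrDl lerD ?src//.
rewrite -!mulrA ler_wpM2l ?p_ge0// ler_wpM2l ?echo_moment_ge0//.
by rewrite mulrC mulrA ler_wpM2r// HK.
Qed.

End moments.

(** It splits the signed weight of the cross term into two nonnegative ones, the only kind that the
    one-step identity accepts. *)
Lemma spowE (R : realType) (h x : R) : h != 0 ->
  spow h x = Num.max x 0 `^ h - Num.max (- x) 0 `^ h.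
Proof.
move=> h0; rewrite /spow; case: (leP 0 x) => x0.
  by rewrite [X in _ - X `^ _]max_r ?oppr_le0// powR0// subr0.
by rewrite max_l ?oppr_ge0 1?ltW// powR0// add0r.
Qed.

Lemma max0_powR_le (R : realType) (h x : R) : 0 < h -> Num.max x 0 `^ h <= `|x| `^ h.
Proof.
move=> h0; rewrite ge0_ler_powR ?nnegrE ?(ltW h0)// ?le_max ?lexx ?orbT//.
by rewrite ge_max ler_norm normr_ge0.
Qed.

Lemma exists_between_max (R : realFieldType) (x y z : R) : x < z -> y < z ->
  exists b, [/\ x < b, y < b & b < z].
Proof.
move=> xz yz; have Mz : Num.max x y < z by rewrite gt_max xz.
have xM : x <= Num.max x y by rewrite le_max lexx.
have yM : y <= Num.max x y by rewrite le_max lexx orbT.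
by exists ((Num.max x y + z) / 2); move: (Num.max x y) xM yM Mz => M; split; lra.
Qed.

(** * Moments of the centered walk *)

Section centered_moments.
Context (d : measure_display) (T : measurableType d) (R : realType).
Variable P : probability T R.
Variables (p : R) (X xi : {RV P >-> R}).
Variables (Xs : nat -> {RV P >-> R}) (eps : nat -> {RV P >-> bool}).
Variables (U : nat -> {RV P >-> nat}) (xis : nat -> {RV P >-> R}).
Hypothesis p01 : 0 < p <= 1.
Hypothesis hwalk : is_rwes_data Xs eps U xis p X xi.
Hypothesis X_ge0 : forall w, 0 <= X w.
Hypothesis xi_ge0 : forall w, 0 <= xi w.
Hypothesis Xs_ge0 : forall n w, 0 <= Xs n w.
Hypothesis xis_ge0 : forall n w, 0 <= xis n w.

Local Notation step := (echo_step Xs eps U xis).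
Local Notation walk := (echo_walk Xs eps U xis).
Local Notation info := (info Xs eps U xis).
Local Notation adapted := (@adapted d T R info).
Local Notation integrable f := (P.-integrable setT (EFin \o f)).
Local Notation step_moment := (@step_moment d T R P Xs eps U xis).
Local Notation mean := (@step_moment_sum d T R P Xs eps U xis 1).

Variable g : R.
Hypothesis g_gt1 : 1 < g.
Hypothesis g_le2 : g <= 2.
Hypothesis iXg : integrable (fun w => X w `^ g).
Hypothesis ixig : integrable (fun w => xi w `^ g).

Let g_gt0 : 0 < g. Proof. exact: lt_trans g_gt1. Qed.
Let h_gt0 : 0 < g - 1. Proof. by rewrite subr_gt0. Qed.
Let h_neq0 : g - 1 != 0. Proof. by rewrite gt_eqF. Qed.

Lemma integrable_powR1 (Y : {RV P >-> R}) : (forall w, 0 <= Y w) ->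
  integrable (fun w => Y w `^ g) -> integrable (fun w => Y w `^ 1).
Proof.
move=> Y0 iY; apply: (integrable_le (g := fun w => 1 + Y w `^ g)).
- exact: (measurableT_comp (measurable_powR 1)).
- by move=> w; rewrite ger0_norm ?powR_ge0// ler_powR_1D// ltW.
- by apply: integrableDr => //; exact: integrable_cst.
Qed.

Let iX1 := integrable_powR1 X_ge0 iXg.
Let ixi1 := integrable_powR1 xi_ge0 ixig.

Let step_nneg k w : 0 <= step k.+1 w. Proof. exact: step_ge0. Qed.

Lemma integrable_step_g k : integrable (fun w => step k.+1 w `^ g).
Proof. exact: (integrable_step_powR p01 hwalk). Qed.

Lemma integrable_step k : integrable (step k.+1).
Proof.
have := integrable_step_powR p01 hwalk Xs_ge0 xis_ge0 k ltr01 iX1 ixi1.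
by under eq_fun do rewrite powRr1 ?step_nneg//.
Qed.

Lemma step_moment1E k : step_moment 1 k = \int[P]_w step k.+1 w.
Proof. by apply: eq_Rintegral => w _; rewrite powRr1// step_nneg. Qed.

Definition centered n w : R := walk n w - mean n.

Lemma centeredS n w :
  centered n.+1 w = centered n w + (step n.+1 w - step_moment 1 n).
Proof. by rewrite /centered walkS /step_moment_sum big_ord_recr/=; ring. Qed.

Lemma measurable_norm_powR (f : T -> R) (s : R) : measurable_fun setT f ->
  measurable_fun setT (fun w => `|f w| `^ s).
Proof.
move=> mf; apply: (measurableT_comp (measurable_powR s)).
exact: (measurableT_comp (@normr_measurable R setT)).
Qed.

Lemma measurable_centered n : measurable_fun setT (centered n).
Proof. by apply: measurable_funB => //; exact: measurable_walk. Qed.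

Lemma integrable_norm_powRD (f1 f2 : T -> R) :
  measurable_fun setT f1 -> measurable_fun setT f2 ->
  integrable (fun w => `|f1 w| `^ g) -> integrable (fun w => `|f2 w| `^ g) ->
  integrable (fun w => `|f1 w + f2 w| `^ g).
Proof.
move=> m1 m2 i1 i2.
apply: (integrable_le (g := fun w => 2 `^ g * (`|f1 w| `^ g + `|f2 w| `^ g))).
- exact/measurable_norm_powR/measurable_funD.
- by move=> w; rewrite ger0_norm ?powR_ge0// norm_powRD_le2.
- by apply: integrableMlr; exact: integrableDr.
Qed.

Lemma integrable_dev k : integrable (fun w => `|step k.+1 w - step_moment 1 k| `^ g).
Proof.
apply: integrable_norm_powRD => //; first exact: measurable_step.
  by under eq_fun do rewrite ger0_norm ?step_nneg//; exact: integrable_step_g.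
exact: integrable_cst.
Qed.

Lemma integrable_centered n : integrable (fun w => `|centered n w| `^ g).
Proof.
elim: n => [|n IH].
  rewrite (_ : (fun w => _) = fun=> 0); first exact: integrable_cst.
  apply/funext => w; rewrite /centered /echo_walk big_geq// /step_moment_sum.
  by rewrite big_ord0 subrr normr0 powR0// gt_eqF.
under eq_fun do rewrite centeredS.
apply: integrable_norm_powRD => //; first exact: measurable_centered.
  by apply: measurable_funB => //; exact: measurable_step.
exact: integrable_dev.
Qed.

(** Jensen's inequality: the tangent at the mean is integrated, and its linear term vanishes. *)
Lemma step_moment_jensen k : step_moment 1 k `^ g <= step_moment g k.
Proof.
have e0 : 0 <= step_moment 1 k by exact: step_moment_ge0.
set e := step_moment 1 k in e0 *.
have -> : e `^ g = \int[P]_w (e `^ g + g * spow (g - 1) e * (step k.+1 w - e)).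
  have i1 : integrable (fun w => step k.+1 w - e).
    by apply: integrableDr; [exact: integrable_step|exact: integrable_cst].
  rewrite RintegralD//; [|exact: integrable_cst|exact: integrableMlr].
  rewrite Rintegral_cst1 RintegralZl// RintegralB//;
    [|exact: integrable_step|exact: integrable_cst].
  by rewrite Rintegral_cst1 -step_moment1E subrr mulr0 addr0.
apply: le_Rintegral => //.
- apply: integrableDr; first exact: integrable_cst.
  apply: integrableMlr.
  by apply: integrableDr; [exact: integrable_step|exact: integrable_cst].
- exact: integrable_step_g.
- move=> w _; have := @norm_powR_tangent R g e (step k.+1 w) g_gt1.
  by rewrite !ger0_norm ?step_nneg.
Qed.

Lemma dev_moment_le k :
  \int[P]_w (`|step k.+1 w - step_moment 1 k| `^ g) <= 2 * 2 `^ g * step_moment g k.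
Proof.
have e0 : 0 <= step_moment 1 k by exact: step_moment_ge0.
apply: (@le_trans _ _ (\int[P]_w (2 `^ g * (step k.+1 w `^ g + step_moment 1 k `^ g)))).
  apply: le_Rintegral => //; first exact: integrable_dev.
    apply: integrableMlr; apply: integrableDr; first exact: integrable_step_g.
    exact: integrable_cst.
  move=> w _; have := @norm_powRD_le2 R g (step k.+1 w) (- step_moment 1 k) g_gt0.
  by rewrite normrN !(ger0_norm e0) (ger0_norm (step_nneg k w)).
rewrite RintegralZl//; last first.
  by apply: integrableDr; [exact: integrable_step_g|exact: integrable_cst].
rewrite RintegralD//; [|exact: integrable_step_g|exact: integrable_cst].
rewrite Rintegral_cst1 -/(step_moment g k).
have := step_moment_jensen k; rewrite -(ler_pM2l (powR_gt0 g (ltr0n R 2))); lra.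
Qed.

(** The fresh spin contributes [(1 - p) E X] both to the step and to its mean and cancels, leaving a
    multiple of the centered walk. The bound on [F] makes the products integrable through
    [powR_young]. *)
Lemma weighted_step k (F : T -> R) : adapted (4 * k).+1 F ->
  (forall w, 0 <= F w) -> (forall w, F w <= `|centered k.+1 w| `^ (g - 1)) ->
  [/\ integrable (fun w => F w * centered k.+1 w),
      integrable (fun w => F w * (step k.+2 w - step_moment 1 k.+1)) &
      \int[P]_w (F w * (step k.+2 w - step_moment 1 k.+1)) =
      p * echo_moment xi 1 / k.+1%:R * \int[P]_w (F w * centered k.+1 w)].
Proof.
move=> aF F0 FZ; have mF := adapted_info_measurable aF.
have iF : integrable F.
  apply: (integrable_le (g := fun w => 1 + `|centered k.+1 w| `^ g)) => //.
    move=> w; rewrite ger0_norm// (le_trans (FZ w))// ler_powR_1D// ?ltW//.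
    by rewrite gtrDl ltrN10.
  by apply: integrableDr; [exact: integrable_cst|exact: integrable_centered].
have iFs (j : nat) : integrable (fun w => F w * step j.+1 w).
  apply: (integrable_le (g := fun w => `|centered k.+1 w| `^ g + step j.+1 w `^ g)).
  - by apply: measurable_funM => //; exact: measurable_step.
  - move=> w; rewrite ger0_norm ?mulr_ge0 ?step_nneg//.
    apply: (@le_trans _ _ (`|centered k.+1 w| `^ (g - 1) * step j.+1 w)).
      by rewrite ler_wpM2r ?step_nneg.
    by apply: powR_young; rewrite ?step_nneg//; exact: ltW.
  - by apply: integrableDr; [exact: integrable_centered|exact: integrable_step_g].
have iFs1 (j : 'I_k.+1) : integrable (fun w => F w * step j.+1 w `^ 1).
  by under eq_fun do rewrite powRr1 ?step_nneg//.
have [_] := mul_step_moment p01 hwalk Xs_ge0 xis_ge0 ltr01 aF F0 iX1 ixi1 iF iFs1.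
under [in X in X = _ -> _]eq_Rintegral do rewrite powRr1 ?step_nneg//.
have -> : \sum_(j < k.+1) \int[P]_w (F w * step j.+1 w `^ 1) = \int[P]_w (F w * walk k.+1 w).
  under [RHS]eq_Rintegral do rewrite walkE mulr_sumr.
  rewrite Rintegral_sum//; apply: eq_bigr => j _; apply: eq_Rintegral => w _.
  by rewrite powRr1// step_nneg.
move=> E.
have iFw : integrable (fun w => F w * walk k.+1 w).
  under eq_fun do rewrite walkE mulr_sumr.
  exact: integrable_sumr.
have iFc c : integrable (fun w => c * F w) by exact: integrableMlr.
split.
- rewrite (_ : (fun w => _) = fun w => F w * walk k.+1 w + (- mean k.+1) * F w).
    exact: integrableDr.
  by apply/funext => w; rewrite /centered; ring.
- rewrite (_ : (fun w => _) = fun w => F w * step k.+2 w + (- step_moment 1 k.+1) * F w).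
    exact: integrableDr.
  by apply/funext => w; ring.
under eq_Rintegral do rewrite mulrBr [F _ * step_moment _ _]mulrC.
rewrite RintegralB// RintegralZl// E.
under [in RHS]eq_Rintegral do rewrite /centered mulrBr [F _ * mean _]mulrC.
rewrite RintegralB// RintegralZl//.
rewrite (step_momentS p01 hwalk Xs_ge0 xis_ge0 k ltr01 iX1 ixi1).
by rewrite -/(mean k.+1); ring.
Qed.

(** [norm_powRD_le] expands the new centered walk around [Z]. Its linear term is computed by
    [weighted_step] for both signed parts and recombined by [spow (g - 1) Z * Z = |Z|^g]; the
    remainder [2 g |B|^g] costs another [2 * 2^g] in [dev_moment_le]. *)
Lemma centered_moment_rec k :
  \int[P]_w (`|centered k.+2 w| `^ g) <=
  (1 + g * (p * echo_moment xi 1) / k.+1%:R) * (\int[P]_w (`|centered k.+1 w| `^ g))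
    + 4 * g * 2 `^ g * step_moment g k.+1.
Proof.
pose Z := centered k.+1.
pose B w := step k.+2 w - step_moment 1 k.+1.
pose F1 w := Num.max (Z w) 0 `^ (g - 1).
pose F2 w := Num.max (- Z w) 0 `^ (g - 1).
have aZ : adapted (4 * k).+1 Z.
  apply: measurable_funB; last exact: measurable_cst.
  exact: (@adapted_walk _ _ _ _ Xs eps U xis k).
have aF1 : adapted (4 * k).+1 F1.
  by apply: adapted_powR; apply: measurable_maxr => //; exact: measurable_cst.
have aF2 : adapted (4 * k).+1 F2.
  apply: adapted_powR; apply: measurable_maxr; last exact: measurable_cst.
  exact: measurable_funN.
have [i1 j1 E1] := @weighted_step k F1 aF1 (fun w => powR_ge0 _ _)
  (fun w => max0_powR_le _ h_gt0).
have F2_le w : F2 w <= `|Z w| `^ (g - 1) by rewrite -normrN; exact: max0_powR_le.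
have [i2 j2 E2] := @weighted_step k F2 aF2 (fun w => powR_ge0 _ _) F2_le.
have spF w : spow (g - 1) (Z w) = F1 w - F2 w by exact: spowE.
have iB : integrable (fun w => `|B w| `^ g) by exact: integrable_dev.
have iZ : integrable (fun w => `|Z w| `^ g) by exact: integrable_centered.
have jF : integrable (fun w => spow (g - 1) (Z w) * B w).
  rewrite (_ : (fun w => _) = fun w => F1 w * B w + (-1) * (F2 w * B w)).
    by apply: integrableDr => //; exact: integrableMlr.
  by apply/funext => w; rewrite spF; ring.
have cross : \int[P]_w (spow (g - 1) (Z w) * B w) =
    p * echo_moment xi 1 / k.+1%:R * \int[P]_w (`|Z w| `^ g).
  under eq_Rintegral do rewrite spF mulrBl.
  rewrite RintegralB// E1 E2 -mulrBr -RintegralB//; congr (_ * _).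
  apply: eq_Rintegral => w _; rewrite -mulrBl -spF mul_spow//.
  by rewrite subrK.
apply: (@le_trans _ _ (\int[P]_w (`|Z w| `^ g + g * (spow (g - 1) (Z w) * B w)
    + 2 * g * `|B w| `^ g))).
  apply: le_Rintegral => //; first exact: integrable_centered.
    apply: integrableDr; last exact: integrableMlr.
    by apply: integrableDr => //; exact: integrableMlr.
  move=> w _; rewrite centeredS -/(Z w) -/(B w) mulrA.
  exact: norm_powRD_le.
rewrite RintegralD//; last 2 first.
  by apply: integrableDr => //; exact: integrableMlr.
  exact: integrableMlr.
rewrite RintegralD//; last exact: integrableMlr.
rewrite !RintegralZl// cross.
rewrite [leRHS](_ : _ = \int[P]_w (`|Z w| `^ g)
    + g * (p * echo_moment xi 1 / k.+1%:R * \int[P]_w (`|Z w| `^ g))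
    + 2 * g * (2 * 2 `^ g * step_moment g k.+1)); last by rewrite -/Z; ring.
by rewrite lerD2l ler_pM2l ?mulr_gt0//; exact: dev_moment_le.
Qed.

Lemma centered_source b : 1 <= b -> p * echo_moment xi g < b ->
  exists2 K, 0 <= K & forall n, (0 < n)%N ->
    \int[P]_w (`|centered n.+1 w| `^ g) <=
    (1 + g * (p * echo_moment xi 1) / n%:R) * (\int[P]_w (`|centered n w| `^ g))
    + K * (rising b n / n%:R).
Proof.
move=> b1 mb.
have [K K0 HK] := step_moment_bound p01 hwalk Xs_ge0 xis_ge0 g_gt0 b1 mb iXg ixig.
have c0 : 0 <= 4 * g * 2 `^ g by rewrite !mulr_ge0 ?powR_ge0// ltW.
exists (4 * g * 2 `^ g * K); first exact: mulr_ge0.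
case=> // k _; apply: (le_trans (centered_moment_rec k)).
by rewrite lerD2l -[leRHS]mulrA ler_wpM2l.
Qed.

Lemma subcritical_centered_moment b : 1 <= b ->
  p * echo_moment xi g < b -> g * (p * echo_moment xi 1) < b ->
  exists2 K, 0 <= K & forall n, (0 < n)%N ->
    \int[P]_w (`|centered n w| `^ g) <= K * n%:R `^ b.
Proof.
move=> b1 mb gb; have [C C0 HC] := centered_source b1 mb.
have r0 : 0 <= g * (p * echo_moment xi 1).
  apply: mulr_ge0; first exact: ltW.
  by apply: mulr_ge0; [case/andP: p01 => /ltW|exact: echo_moment_ge0].
have [K K0 HK] := @subcritical_growth R _ b C
  (fun n => \int[P]_w (`|centered n w| `^ g)) r0 gb C0 HC.
exists K => // n n0; apply: (le_trans (HK n n0)).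
by rewrite ler_wpM2l// rising_le_powR.
Qed.

(** The homogeneous rate is now [g] itself, so the source rate [b] has to be fitted between
    [max(1, p m_g)] and [g]; there is room exactly because [p m_g < g]. *)
Lemma critical_centered_moment : p * echo_moment xi g < g -> p * echo_moment xi 1 = 1 ->
  exists2 K, 0 <= K & forall n, (0 < n)%N ->
    \int[P]_w (`|centered n w| `^ g) <= K * n%:R `^ g.
Proof.
move=> mg m1.
have [b [b1 mb bg]] : exists b, [/\ 1 <= b, p * echo_moment xi g < b & b < g].
  by have [b [/ltW]] := exists_between_max g_gt1 mg; exists b.
have [C C0 HC] := centered_source b1 mb.
have [n n0|K K0 HK] := @critical_growth R g b C
  (fun n => \int[P]_w (`|centered n w| `^ g)) (le_trans ler01 b1) bg C0.
  by have := HC n n0; rewrite m1 mulr1.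
exists K => // n n0; apply: (le_trans (HK n n0)).
by rewrite ler_wpM2l// rising_le_powR// ltW.
Qed.

Lemma meanS n : (0 < n)%N ->
  mean n.+1 = (1 + p * echo_moment xi 1 / n%:R) * mean n + (1 - p) * spin_moment X 1.
Proof. by move=> n0; exact: (step_moment_sumS p01 hwalk). Qed.

End centered_moments.

(** * From weighted sums to convergence along all indices *)

Section gap_filling.
Context {R : realType}.

(** Close to [1/n], but telescoping: the indices in (m, n] have total weight exactly [ln (n/m)]. *)
Definition ln_weight (n : nat) : R := ln n%:R - ln n.-1%:R.

Lemma ln_weight_ge0 n : (1 < n)%N -> 0 <= ln_weight n.
Proof.
case: n => [|[|n]]// _; rewrite subr_ge0 ler_ln ?posrE ?ltr0n//.
by rewrite ler_nat.
Qed.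

(** The tangent of the convex function [t^(-s)] at [y]. With [r = x/y] it reduces to
    [r^(-s) >= 1 - s ln r >= 1 + s (1 - r)]. *)
Lemma powRN_convex (s x y : R) : 0 < s -> 0 < x -> 0 < y ->
  s * ((y - x) * y `^ (- (s + 1))) <= x `^ (- s) - y `^ (- s).
Proof.
move=> s0 x0 y0; have r0 : 0 < x / y by exact: divr_gt0.
have r1 : 1 + s * (1 - x / y) <= (x / y) `^ (- s).
  rewrite /powR gt_eqF//; apply: le_trans (expR_ge1Dx _).
  rewrite lerD2l mulNr -mulrN ler_wpM2l ?(ltW s0)//.
  suff : ln (x / y) <= x / y - 1 by lra.
  by have := @le_ln1Dx R (x / y - 1); rewrite subrKC; apply; lra.
have -> : y `^ (- (s + 1)) = y `^ (- s) / y.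
  by rewrite opprD powRD ?(gt_eqF y0) ?implybT// powR_inv1// ltW.
have -> : x `^ (- s) = (x / y) `^ (- s) * y `^ (- s).
  by rewrite -powRM ?(ltW r0) ?(ltW y0)// divfK// gt_eqF.
have ys := powR_gt0 (- s) y0.
have -> : s * ((y - x) * (y `^ (- s) / y)) = (s * (1 - x / y)) * y `^ (- s).
  by field; rewrite gt_eqF.
have := r1; rewrite -(ler_pM2r ys); lra.
Qed.

(** Integral comparison in the variable [ln i]: by [powRN_convex] each term is at most an increment
    of [- (ln i)^(-(g-1)) / (g-1)], and the sum telescopes. *)
Lemma ln_weight_summable (g : R) : 1 < g -> forall n,
  \sum_(4 <= i < n) ln_weight i * (ln i%:R) `^ (- g)
    <= (ln 3) `^ (- (g - 1)) / (g - 1).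
Proof.
move=> g1 n; have s0 : 0 < g - 1 by rewrite subr_gt0.
rewrite ler_pdivlMr//.
suff H m : \sum_(4 <= i < m.+4) ln_weight i * (ln i%:R) `^ (- g) * (g - 1)
    <= (ln 3) `^ (- (g - 1)) - (ln m.+3%:R) `^ (- (g - 1)).
  case: (ltnP n 4) => n4; first by rewrite big_geq ?mul0r ?powR_ge0// ltnW.
  rewrite -(subnK n4) addn4 mulr_suml (le_trans (H _))//.
  by rewrite lerBlDr lerDl powR_ge0.
elim: m => [|m IH]; first by rewrite big_geq// subrr.
rewrite big_nat_recr//=.
have l1 : 0 < ln m.+3%:R :> R by rewrite ln_gt0// ltr1n.
have l2 : 0 < ln m.+4%:R :> R by rewrite ln_gt0// ltr1n.
have := powRN_convex s0 l1 l2; rewrite subrK -/(ln_weight m.+4) mulrC.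
move: IH; lra.
Qed.

Lemma block_length (N j : nat) : (1 < j)%N -> (j <= N)%N ->
  exists q, [/\ (0 < q)%N, (q * j <= N)%N, (N <= 2 * (q * j))%N & (2 * q <= N)%N].
Proof.
move=> j1 jN; exists (N %/ j)%N.
have j0 : (0 < j)%N by exact: ltnW.
have q0 : (0 < N %/ j)%N by rewrite divn_gt0.
have := divn_eq N j; have := ltn_pmod N j0.
by move: (N %/ j)%N (N %% j)%N q0 => q r q0 rj NE; split => //; nia.
Qed.

Lemma exists_nat_ge (x : R) : exists j : nat, x <= j%:R.
Proof. by exists (Num.truncn x).+1; rewrite ltW// truncnS_gt. Qed.

(* If [S N / a N] is far from [l], monotonicity keeps it far from [l] on a block
   of indices next to [N] of fixed logarithmic length. *)
Lemma cvg_fill_gaps (S a e : nat -> R) (l g C : R) (N0 : nat) :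
  0 < g -> (1 < N0)%N -> 0 <= l ->
  {homo S : m n / (m <= n)%N >-> m <= n} -> (forall n, 0 <= S n) ->
  (forall n, (N0 <= n)%N -> 0 < a n) ->
  (forall m n, (N0 <= m)%N -> (m <= n)%N ->
     a m <= a n /\ a n <= (n%:R / m%:R) ^+ 2 * a m) ->
  e n @[n --> \oo] --> l ->
  (forall n, \sum_(N0 <= i < n) ln_weight i * `|S i / a i - e i| `^ g <= C) ->
  S n / a n @[n --> \oo] --> l.
Proof.
move=> g0 N01 l0 hS S0 a0 ha he hC.
pose D i := `|S i / a i - e i| `^ g.
pose W n := \sum_(N0 <= i < n) ln_weight i * D i.
have D0 i : 0 <= D i by exact: powR_ge0.
have WS n : (N0 <= n)%N -> W n.+1 = W n + ln_weight n * D n.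
  by move=> n0; rewrite /W big_nat_recr.
have ndW : nondecreasing_seq W.
  apply/nondecreasing_seqP => n; case: (leqP N0 n) => n0.
    by rewrite WS// lerDl mulr_ge0// ln_weight_ge0// (leq_trans N01).
  by rewrite /W !big_geq// ltnW.
have /cvg_ex[L cvW] : cvgn W.
  apply: nondecreasing_is_cvgn => //; exists C => _ [n _ <-]; exact: hC.
apply/cvgrPdist_lt => ep ep0.
pose ep4 : R := ep / 4.
have ep40 : 0 < ep4 by rewrite /ep4; lra.
(* Blocks will have relative length between [x/2] and [x], with [x = 1/j]. The factor 12 comes from
   [(l - ep) (1 + 2 x)^2 <= l - ep / 2], since [4 x + 4 x^2 <= 6 x] for [x <= 1/2]. *)
have [j0 hj0] := exists_nat_ge (12 * (l + ep) / ep).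
have [j [j1 hj]] : exists j, (1 < j)%N /\ 12 * (l + ep) / ep <= j%:R.
  exists j0.+2; split => //; apply: (le_trans hj0); rewrite ler_nat.
  by rewrite -addn2 leq_addr.
have jR : 2 <= j%:R :> R by rewrite ler_nat.
have jR0 : 0 < j%:R :> R by rewrite (lt_le_trans _ jR).
have [x xE] : exists x : R, x = j%:R^-1 by exists j%:R^-1.
have x0 : 0 < x by rewrite xE invr_gt0.
have x2 : 2 * x <= 1 by rewrite xE -ler_pdivlMr ?invr_gt0// invrK mul1r.
have xep : 12 * x * (l + ep) <= ep.
  move: hj; rewrite ler_pdivrMr// => H.
  have -> : 12 * x * (l + ep) = 12 * (l + ep) * x by ring.
  rewrite [leRHS](_ : _ = j%:R * ep * x); first by rewrite ler_wpM2r// ltW.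
  by rewrite mulrAC xE divff ?mul1r// gt_eqF.
pose eta : R := ep4 `^ g * ln (1 + x / 2).
have lnx0 : 0 < ln (1 + x / 2) by rewrite ln_gt0//; lra.
have eta0 : 0 < eta by rewrite mulr_gt0// powR_gt0.
have [M1 _ HM1] : \forall n \near \oo, `|l - e n| < ep4.
  by move/cvgrPdist_lt : he; apply.
have [M2 _ HM2] : \forall n \near \oo, `|L - W n| < eta / 2.
  by move/cvgrPdist_lt : cvW; apply; exact: divr_gt0.
have [M0 [N0M M1M M2M]] : exists M0, [/\ N0 <= M0, M1 <= M0 & M2 <= M0]%N.
  by exists (maxn N0 (maxn M1 M2)); rewrite !leq_max !leqnn !orbT.
(* A deviation of [ep4] throughout (m, n] would add at least [ep4^g ln (n/m) >= eta] to [W], while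
   beyond [M0] convergence of [W] leaves increments smaller than [eta]. *)
have block m n : (M0 <= m)%N -> (m < n)%N -> m%:R * (1 + x / 2) <= n%:R ->
    ~ (forall i, (m < i <= n)%N -> ep4 <= `|S i / a i - e i|).
  move=> Mm mn mxn Hi.
  have Wmn k : (k <= n - m)%N ->
      ep4 `^ g * (ln (m + k)%:R - ln m%:R) <= W (m + k).+1 - W m.+1.
    elim: k => [_|k IH kn]; first by rewrite addn0 !subrr mulr0.
    have mk : (M0 <= (m + k).+1)%N by rewrite (leq_trans Mm)// -addnS leq_addr.
    rewrite addnS [W (m + k).+2]WS ?(leq_trans N0M)//.
    have := IH (ltnW kn).
    have : ep4 `^ g * ln_weight (m + k).+1 <= ln_weight (m + k).+1 * D (m + k).+1.
      rewrite mulrC ler_wpM2l ?ln_weight_ge0//.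
        by rewrite (leq_trans N01)// (leq_trans N0M).
      rewrite ge0_ler_powR ?nnegrE ?(ltW g0) ?(ltW ep40)//.
      by apply: Hi; clear - kn; lia.
    rewrite /ln_weight [(m + k).+1.-1]/= !mulrBr; clear; lra.
  have := Wmn (n - m)%N (leqnn _); rewrite subnKC ?(ltnW mn)//; apply/negP; rewrite -ltNge.
  have : W n.+1 - W m.+1 < eta.
    have /= := HM2 n.+1 (leq_trans M2M (leq_trans Mm (ltnW (leqW mn)))).
    have /= := HM2 m.+1 (leq_trans M2M (leqW Mm)).
    rewrite !ltr_norml => /andP[h1 h2] /andP[h3 h4]; clear - h1 h2 h3 h4; lra.
  move=> /lt_le_trans; apply; rewrite /eta ler_wpM2l ?powR_ge0//.
  have m0 : (0 < m)%N by rewrite (leq_trans _ Mm)// (leq_trans _ N0M)// ltnW.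
  have n0 : (0 < n)%N by exact: ltn_trans mn.
  rewrite -ln_div ?posrE ?ltr0n//.
  rewrite ler_ln ?posrE ?divr_gt0 ?ltr0n//; last by clear - x0; lra.
  by rewrite ler_pdivlMr ?ltr0n// mulrC.
near=> N.
(* Since [q <= N / 2], even the block to the left of [N] starts at or after [M0]. *)
have hN : (2 * M0 + j <= N)%N by near: N; exact: nbhs_infty_ge.
have jN : (j <= N)%N by rewrite (leq_trans _ hN)// leq_addl.
have [q [q0 qj qj2 q2]] := block_length j1 jN.
have M0N : (M0 <= N)%N by clear - hN; lia.
have M0Nq : (M0 <= N - q)%N by clear - hN q2; lia.
have N00 : (0 < N)%N by clear - jN j1; lia.
have NR : 0 < N%:R :> R by rewrite ltr0n.
have qx : q%:R <= N%:R * x.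
  by rewrite xE ler_pdivlMr// -natrM ler_nat.
have qx2 : N%:R * (x / 2) <= q%:R.
  rewrite mulrA ler_pdivrMr// xE ler_pdivrMr// -!natrM ler_nat.
  by rewrite mulnAC mulnC.
rewrite ltNge; apply/negP => far.
have aN : 0 < a N by apply: a0; exact: leq_trans M0N.
(* Too large at [N]: the block lies to the right, where [S] does not decrease and [a] grows at most
   by [(1 + x)^2]. The excess stays above [ep / 2], hence above [ep4] relative to [e i]. *)
case: (leP l (S N / a N)) => lY.
  have YN : (l + ep) * a N <= S N.
    rewrite -ler_pdivlMr//; move: far; rewrite distrC ger0_norm ?subr_ge0//.
    by rewrite lerBrDl addrC.
  apply: (@block N (N + q)%N) => //; first by rewrite -{1}(addn0 N) ltn_add2l.
    by rewrite mulrDr mulr1 natrD lerD2l.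
  move=> i /andP[Ni iN].
  have N0i : (N0 <= i)%N by rewrite (leq_trans N0M)// (leq_trans M0N)// ltnW.
  have [ai1 ai2] := ha N i (leq_trans N0M M0N) (ltnW Ni).
  have ai0 : 0 < a i by exact: a0.
  have iNx : i%:R / N%:R <= 1 + x.
    rewrite ler_pdivrMr// mulrDl mul1r [x * _]mulrC.
    apply: (@le_trans _ _ (N + q)%:R); first by rewrite ler_nat.
    by rewrite natrD lerD2l.
  have iN0 : 0 <= i%:R / N%:R :> R by rewrite divr_ge0.
  have Si : S N <= S i by apply: hS; exact: ltnW.
  have Yi : l + ep / 2 <= S i / a i.
    rewrite ler_pdivlMr// (le_trans _ Si)// (le_trans _ YN)//.
    have h1 : (i%:R / N%:R) ^+ 2 <= (1 + x) ^+ 2 by rewrite !expr2; apply: ler_pM.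
    have h2 : (l + ep / 2) * (1 + x) ^+ 2 <= l + ep.
      by clear - x0 x2 xep l0 ep0; nra.
    apply: (@le_trans _ _ ((l + ep / 2) * ((1 + x) ^+ 2 * a N))).
      apply: ler_wpM2l; first by clear - l0 ep0; lra.
      by apply: (le_trans ai2); apply: ler_wpM2r => //; exact: ltW.
    by rewrite mulrA ler_wpM2r// ltW.
  have /= := HM1 i (leq_trans M1M (leq_trans M0N (ltnW Ni))).
  rewrite ltr_norml => /andP[h1 h2].
  apply: le_trans (ler_norm _); move: h1 h2 Yi; rewrite /ep4; clear; lra.
(* Too small at [N]: the block lies to the left, where [S i <= S N] and [a N <= (1 + 2 x)^2 a i],
   because [1/(1 - x) <= 1 + 2 x]. Nonnegativity of [S] forces [l - ep >= 0], which the
   multiplication of inequalities needs. *)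
have YN : S N <= (l - ep) * a N.
  rewrite -ler_pdivrMr//; move: far; rewrite ger0_norm ?subr_ge0; last exact: ltW.
  by rewrite lerBrDr addrC -lerBrDr.
have lep : 0 <= l - ep.
  by rewrite -(pmulr_lge0 _ aN) (le_trans _ YN)// S0.
have qN : (q <= N)%N by clear - q2; lia.
have NqR : (N - q)%:R = N%:R - q%:R :> R by rewrite natrB.
apply: (@block (N - q)%N N) => //; first by clear - q0 N00; lia.
  by rewrite NqR; clear - qx2 NR x0; nra.
move=> i /andP[qi iN].
have N0i : (N0 <= i)%N by rewrite (leq_trans N0M)// (leq_trans M0Nq)// ltnW.
have [ai1 ai2] := ha i N N0i iN.
have ai0 : 0 < a i by exact: a0.
have i0 : 0 < i%:R :> R by rewrite ltr0n (leq_trans _ N0i)// ltnW.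
have iR : N%:R - q%:R <= i%:R :> R by rewrite -NqR ler_nat ltnW.
have Nix : N%:R / i%:R <= 1 + 2 * x.
  rewrite ler_pdivrMr//.
  apply: (@le_trans _ _ ((1 + 2 * x) * (N%:R * (1 - x)))).
    have h : 1 <= (1 + 2 * x) * (1 - x) by clear - x0 x2; nra.
    by rewrite mulrCA ler_peMr// ltW.
  by apply: ler_wpM2l; [clear - x0; lra|clear - iR qx; lra].
have iN0 : 0 <= N%:R / i%:R :> R by rewrite divr_ge0.
have Si : S i <= S N by exact: hS.
have Yi : S i / a i <= l - ep / 2.
  rewrite ler_pdivrMr// (le_trans Si)// (le_trans YN)//.
  have h1 : (N%:R / i%:R) ^+ 2 <= (1 + 2 * x) ^+ 2 by rewrite !expr2; apply: ler_pM.
  have h2 : (l - ep) * (1 + 2 * x) ^+ 2 <= l - ep / 2.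
    by clear - x0 x2 xep l0 ep0 lep; nra.
  apply: (@le_trans _ _ ((l - ep) * ((1 + 2 * x) ^+ 2 * a i))).
    apply: ler_wpM2l => //.
    by apply: (le_trans ai2); apply: ler_wpM2r => //; exact: ltW.
  by rewrite mulrA ler_wpM2r// ltW.
have /= := HM1 i (leq_trans M1M (leq_trans M0Nq (ltnW qi))).
rewrite ltr_norml => /andP[h1 h2].
rewrite distrC; apply: le_trans (ler_norm _); move: h1 h2 Yi; rewrite /ep4; clear; lra.
Unshelve. all: by end_near. Qed.

End gap_filling.

(** * Almost sure finiteness of series and L^g norms *)

Section almost_sure.
Context (d : measure_display) (T : measurableType d) (R : realType).
Variable P : probability T R.

Lemma ae_bounded_series (f : nat -> T -> R) (C : R) :
  (forall n w, 0 <= f n w) -> (forall n, P.-integrable setT (EFin \o f n)) ->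
  (forall n, \sum_(i < n) \int[P]_w f i w <= C) ->
  {ae P, forall w, exists c, forall n, \sum_(i < n) f i w <= c}.
Proof.
move=> f0 fi fC.
pose F w := (\sum_(n <oo) (f n w)%:E)%E.
have mf n : measurable_fun setT (fun w => (f n w)%:E).
  by apply/measurable_EFinP; exact: (integrable_measurable (fi n)).
have f0' n w : (0 <= (f n w)%:E)%E by rewrite lee_fin.
have F0 w : (0 <= F w)%E by apply: nneseries_ge0 => n _ _.
have mF : measurable_fun setT F by apply: ge0_emeasurable_sum.
have iF : P.-integrable setT F.
  apply/integrableP; split => //.
  under eq_integral do rewrite gee0_abs//.
  rewrite integral_nneseries//; apply: (@le_lt_trans _ _ C%:E); last exact: ltry.
  apply: lime_le.
    by apply: is_cvg_nneseries => n _ _; exact: integral_ge0.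
  apply: nearW => n; rewrite big_mkord.
  under eq_bigr do rewrite EFin_Rintegral//.
  by rewrite sumEFin lee_fin.
have := integrable_ae measurableT iF; apply: filterS => w /(_ I) Fw.
exists (fine (F w)) => n; rewrite -lee_fin fineK// -sumEFin.
by rewrite -(big_mkord xpredT (fun i => (f i w)%:E)); exact: nneseries_lim_ge.
Qed.

Lemma Lnorm_EFin (g : R) (f : T -> R) : 0 < g ->
  P.-integrable setT (EFin \o (fun w => `|f w| `^ g)) ->
  Lnorm P g%:E (EFin \o f) = ((\int[P]_w (`|f w| `^ g)) `^ g^-1)%:E.
Proof.
move=> g0 fi; rewrite unlock /= -poweR_EFin -EFin_Rintegral//.
Qed.

Lemma Lfun_integrable_norm (g : R) (f : T -> R) : 0 < g -> measurable_fun setT f ->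
  P.-integrable setT (EFin \o (fun w => `|f w| `^ g)) -> f \in Lfun P g%:E.
Proof.
move=> g0 mf fi; rewrite inE; apply/andP; split; rewrite inE//=.
by rewrite /finite_norm Lnorm_EFin// ltry.
Qed.

End almost_sure.

(** * Convergence for nonnegative spins and echoes *)

Section nonneg_walk.
Context (d : measure_display) (T : measurableType d) (R : realType).
Variable P : probability T R.
Variables (p : R) (X xi : {RV P >-> R}).
Variables (Xs : nat -> {RV P >-> R}) (eps : nat -> {RV P >-> bool}).
Variables (U : nat -> {RV P >-> nat}) (xis : nat -> {RV P >-> R}).
Hypothesis p01 : 0 < p <= 1.
Hypothesis hwalk : is_rwes_data Xs eps U xis p X xi.
Hypothesis X_ge0 : forall w, 0 <= X w.
Hypothesis xi_ge0 : forall w, 0 <= xi w.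
Hypothesis Xs_ge0 : forall n w, 0 <= Xs n w.
Hypothesis xis_ge0 : forall n w, 0 <= xis n w.

Local Notation walk := (echo_walk Xs eps U xis).
Local Notation integrable f := (P.-integrable setT (EFin \o f)).
Local Notation mean := (@step_moment_sum d T R P Xs eps U xis 1).
Local Notation centered := (@centered d T R P Xs eps U xis).

Variable g : R.
Hypothesis g_gt1 : 1 < g.
Hypothesis g_le2 : g <= 2.
Hypothesis iXg : integrable (fun w => X w `^ g).
Hypothesis ixig : integrable (fun w => xi w `^ g).

Let g_gt0 : 0 < g. Proof. exact: lt_trans g_gt1. Qed.

Let icentered n : integrable (fun w => `|centered n w| `^ g).
Proof. exact: (integrable_centered p01 hwalk). Qed.

Let mwalk n : measurable_fun setT (walk n).
Proof. exact: measurable_walk. Qed.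

Lemma integrable_walk_powR n : integrable (fun w => `|walk n w| `^ g).
Proof.
rewrite (_ : (fun w => _) = (fun w => `|centered n w + mean n| `^ g)); last first.
  by apply/funext => w; rewrite /centered subrK.
apply: integrable_norm_powRD => //; first exact: measurable_centered.
exact: integrable_cst.
Qed.

(** * Both modes of convergence for a general norming sequence *)

Section norming.
Variables (a : nat -> R) (l K : R).
Hypothesis a_gt0 : forall n, (4 <= n)%N -> 0 < a n.
Hypothesis a_growth : forall m n, (4 <= m)%N -> (m <= n)%N ->
  a m <= a n /\ a n <= (n%:R / m%:R) ^+ 2 * a m.
Hypothesis l_ge0 : 0 <= l.
Hypothesis K_ge0 : 0 <= K.
Hypothesis mean_cvg : mean n / a n @[n --> \oo] --> l.
Hypothesis centered_le : forall n, (4 <= n)%N ->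
  (\int[P]_w (`|centered n w| `^ g)) * ln n%:R `^ g <= K * a n `^ g.

Let dev n w := walk n w / a n - mean n / a n.

Let devE n w : (4 <= n)%N -> `|dev n w| `^ g = `|centered n w| `^ g * (a n)^-1 `^ g.
Proof.
move=> n4; rewrite /dev -mulrBl normrM powRM// [`|(a n)^-1|]ger0_norm//.
by rewrite invr_ge0 ltW// a_gt0.
Qed.

Let idev n : (4 <= n)%N -> integrable (fun w => `|dev n w| `^ g).
Proof.
move=> n4; rewrite (_ : (fun w => _) = fun w => (a n)^-1 `^ g * `|centered n w| `^ g).
  exact: integrableMlr.
by apply/funext => w; rewrite devE// mulrC.
Qed.

Let dev_le n : (4 <= n)%N ->
  \int[P]_w (`|dev n w| `^ g) <= K * ln n%:R `^ (- g).
Proof.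
move=> n4; have l0 : 0 < ln n%:R :> R by rewrite ln_gt0// ltr1n (leq_trans _ n4).
have an0 := a_gt0 n4.
rewrite (@eq_Rintegral _ _ _ _ _ (fun w => `|centered n w| `^ g * (a n)^-1 `^ g)); last first.
  by move=> w _; exact: devE.
rewrite RintegralZr// powRN ler_pdivlMr ?powR_gt0// mulrAC.
have -> : (a n)^-1 `^ g = (a n `^ g)^-1.
  by rewrite -powR_inv1 ?(ltW an0)// -powRrM mulN1r powRN.
rewrite ler_pdivrMr ?powR_gt0//.
exact: centered_le.
Qed.

Lemma norming_cvg_as : cvg_as P (fun n w => walk n w / a n) l.
Proof.
pose f i w := ln_weight (i + 4) * `|dev (i + 4) w| `^ g.
have i4 i : (4 <= i + 4)%N by rewrite leq_addl.
have wt0 i : 0 <= ln_weight (i + 4) :> R by rewrite ln_weight_ge0// (leq_trans _ (i4 i)).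
have shift (F : nat -> R) n : \sum_(4 <= i < n) F i = \sum_(i < n - 4) F (i + 4)%N.
  exact: etrans (big_addn 0 n 4 xpredT F) (big_mkord _ _).
have := @ae_bounded_series d T R P f (K * (ln 3 `^ (- (g - 1)) / (g - 1))).
case.
- by move=> n w; rewrite mulr_ge0 ?powR_ge0.
- by move=> n; apply: integrableMlr; exact: idev.
- move=> n; apply: le_trans (ler_wpM2l K_ge0 (ln_weight_summable g_gt1 (n + 4))).
  rewrite shift addnK mulr_sumr; apply: ler_sum => i _.
  rewrite /f RintegralZl//; last exact: idev.
  by rewrite mulrCA ler_wpM2l// dev_le.
move=> N [mN PN HN]; exists N; split => // w Hw; apply: HN => /= -[c Hc]; apply: Hw => /=.
apply: (@cvg_fill_gaps R (fun n => walk n w) a (fun n => mean n / a n) l g c 4) => //.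
- exact: walk_homo.
- by move=> n; exact: walk_ge0.
- by move=> n; rewrite shift; exact: Hc.
Qed.

Lemma norming_cvg_Lp : cvg_Lp P g (fun n w => walk n w / a n) l.
Proof.
split.
  move=> n; apply: Lfun_integrable_norm => //.
    by apply: measurable_funM => //; exact: measurable_cst.
  rewrite (_ : (fun w => _) = fun w => `|(a n)^-1| `^ g * `|walk n w| `^ g).
    by apply: integrableMlr; exact: integrable_walk_powR.
  by apply/funext => w; rewrite normrM powRM// mulrC.
pose c n := mean n / a n - l.
(* Minkowski separates the fluctuation, whose norm is the [g]-th root of [K (ln n)^(-g)], from the
   deterministic error of the mean. *)
pose b n : R := K `^ g^-1 * (ln n%:R)^-1 + `|c n|.
have ub n : (4 <= n)%N -> (Lnorm P g%:E (fun w => (walk n w / a n - l)%:E) <= (b n)%:E)%E.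
  move=> n4; have l0 : 0 < ln n%:R :> R by rewrite ln_gt0// ltr1n (leq_trans _ n4).
  have -> : (fun w => (walk n w / a n - l)%:E) = EFin \o (dev n \+ cst (c n)).
    by apply/funext => w /=; rewrite /dev /c addrA subrK.
  have md : measurable_fun setT (dev n).
    apply: measurable_funB; last exact: measurable_cst.
    by apply: measurable_funM => //; exact: measurable_cst.
  apply: (le_trans (minkowski_EFin P md (measurable_cst _) (ltW g_gt1))).
  rewrite Lnorm_EFin//; last exact: idev.
  rewrite Lnorm_EFin//; last exact: (integrable_cst P (`|c n| `^ g)).
  rewrite (_ : \int[P]_w (`|cst (c n) w| `^ g) = `|c n| `^ g); last first.
    exact: (Rintegral_cst1 P (`|c n| `^ g)).
  rewrite -EFinD lee_fin -powRrM divff ?gt_eqF// powRr1//.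
  rewrite lerD2r.
  apply: (@le_trans _ _ ((K * ln n%:R `^ (- g)) `^ g^-1)).
    rewrite ge0_ler_powR ?nnegrE ?invr_ge0 ?(ltW g_gt0)//.
    - by apply: Rintegral_ge0 => w _; exact: powR_ge0.
    - by rewrite mulr_ge0// powR_ge0.
    - exact: dev_le.
  by rewrite powRM ?powR_ge0// -powRrM mulNr divff ?gt_eqF// powR_inv1 ?(ltW l0).
have b0 : b n @[n --> \oo] --> 0.
  suff : b n @[n --> \oo] --> K `^ g^-1 * 0 + `|0 : R|.
    by rewrite mulr0 normr0 addr0.
  apply: cvgD; first by apply: cvgMr; exact: cvgn_inv_ln.
  apply: cvg_norm; rewrite -[X in _ --> X](subrr l).
  by apply: cvgB => //; exact: cvg_cst.
apply: (@squeeze_cvge _ _ _ _ (fun=> 0%E) _ (fun n => (b n)%:E)).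
- near=> n; rewrite Lnorm_ge0 ub//; near: n; exact: nbhs_infty_ge.
- exact: cvg_cst.
- by apply: cvg_EFin => //; exact: nearW.
Unshelve. all: by end_near. Qed.

End norming.

(** With [r = n/m] the second claim is [ln n <= r ln m]. As [ln n <= ln m + r - 1], it follows from
    [(r - 1) (ln m - 1) >= 0]. Starting at 4 ensures [ln m >= 1], by [ln 4 = 2 ln 2] and
    [ln 2 >= 1/2]. *)
Lemma critical_norming m n : (4 <= m)%N -> (m <= n)%N ->
  (m%:R * ln m%:R : R) <= n%:R * ln n%:R /\
  n%:R * ln n%:R <= (n%:R / m%:R) ^+ 2 * (m%:R * ln m%:R) :> R.
Proof.
move=> m4 mn; have m0 : 0 < m%:R :> R by rewrite ltr0n (leq_trans _ m4).
have n0 : 0 < n%:R :> R by rewrite ltr0n (leq_trans _ mn)// (leq_trans _ m4).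
have mnR : m%:R <= n%:R :> R by rewrite ler_nat.
have ln2 : 2^-1 <= ln 2 :> R.
  have := @le_ln1Dx R (- 2^-1); rewrite (_ : 1 - 2^-1 = 2^-1 :> R); last by field.
  by rewrite lnV ?posrE// lerN2; apply; lra.
have lm1 : 1 <= ln m%:R :> R.
  apply: (@le_trans _ _ (ln 4)); last by rewrite ler_ln ?posrE// ler_nat.
  rewrite (_ : 4 = 2 * 2 :> R); last by ring.
  by rewrite lnM ?posrE//; lra.
have lmn : ln m%:R <= ln n%:R :> R by rewrite ler_ln ?posrE.
split; first by apply: ler_pM => //; exact: le_trans lm1.
have lnm : ln n%:R <= ln m%:R + (n%:R / m%:R - 1) :> R.
  rewrite -lerBlDl -ln_div ?posrE//.
  have := @le_ln1Dx R (n%:R / m%:R - 1); rewrite subrKC; apply.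
  by rewrite -subr_gt0 opprK subrK divr_gt0.
have -> : (n%:R / m%:R) ^+ 2 * (m%:R * ln m%:R) = n%:R * (n%:R / m%:R * ln m%:R) :> R.
  by field; rewrite gt_eqF.
rewrite ler_pM2l//; apply: (le_trans lnm).
have r1 : 1 <= n%:R / m%:R :> R by rewrite ler_pdivlMr// mul1r.
rewrite -subr_ge0 (_ : _ - _ = (n%:R / m%:R - 1) * (ln m%:R - 1)); last by ring.
by rewrite mulr_ge0 ?subr_ge0.
Qed.

Lemma subcritical_norming m n : (4 <= m)%N -> (m <= n)%N ->
  (m%:R : R) <= n%:R /\ n%:R <= (n%:R / m%:R) ^+ 2 * m%:R :> R.
Proof.
move=> m4 mn; have m0 : 0 < m%:R :> R by rewrite ltr0n (leq_trans _ m4).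
rewrite ler_nat mn; split => //.
have -> : (n%:R / m%:R) ^+ 2 * m%:R = n%:R * (n%:R / m%:R) :> R by field; rewrite gt_eqF.
by rewrite ler_peMr// ler_pdivlMr// mul1r ler_nat.
Qed.

Lemma moment1E (Y : {RV P >-> R}) : (forall w, 0 <= Y w) ->
  \int[P]_w (Y w `^ 1) = \int[P]_w Y w.
Proof. by move=> Y0; apply: eq_Rintegral => w _; rewrite powRr1. Qed.

Hypothesis g_moment : p * (\int[P]_w (xi w `^ g)) < g.

Let onem_p : 0 <= 1 - p. Proof. by case/andP: p01; rewrite subr_ge0. Qed.

Lemma critical_nonneg : p * (\int[P]_w xi w) = 1 ->
  let Y := fun n w => walk n w / (n%:R * ln n%:R) in
  let l := (1 - p) * \int[P]_w X w in
  cvg_as P Y l /\ cvg_Lp P g Y l.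
Proof.
rewrite -moment1E// -[in _ * \int[P]_w X w](moment1E X_ge0) => q1 Y l.
have [K K0 HK] := critical_centered_moment p01 hwalk X_ge0 xi_ge0 Xs_ge0 xis_ge0
  g_gt1 g_le2 iXg ixig g_moment q1.
have l0 : 0 <= l by rewrite mulr_ge0// Rintegral_ge0// => w _; exact: powR_ge0.
have ml : mean n / (n%:R * ln n%:R) @[n --> \oo] --> l.
  apply: critical_mean => n n0.
  rewrite (meanS p01 hwalk X_ge0 xi_ge0 Xs_ge0 xis_ge0 g_gt1 iXg ixig n0).
  by rewrite /echo_moment q1 mul1r.
have a0 n : (4 <= n)%N -> 0 < n%:R * ln n%:R :> R.
  move=> n4; rewrite mulr_gt0 ?ltr0n ?ln_gt0 ?ltr1n//; exact: leq_trans n4.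
have cl n : (4 <= n)%N ->
    (\int[P]_w (`|centered n w| `^ g)) * ln n%:R `^ g <= K * (n%:R * ln n%:R) `^ g.
  move=> n4; rewrite powRM//; last by rewrite ln_ge0// ler1n (leq_trans _ n4).
  by rewrite mulrA ler_wpM2r ?powR_ge0// HK// (leq_trans _ n4).
split.
  exact: (norming_cvg_as a0 critical_norming l0 K0 ml cl).
exact: (norming_cvg_Lp a0 K0 ml cl).
Qed.

Lemma subcritical_nonneg : p * (\int[P]_w xi w) < 1 ->
  let Y := fun n w => walk n w / n%:R in
  let l := (1 - p) * (\int[P]_w X w) / (1 - p * \int[P]_w xi w) in
  cvg_as P Y l /\ cvg_Lp P g Y l.
Proof.
rewrite -moment1E// -[in _ * \int[P]_w X w](moment1E X_ge0) => q1 Y l.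
have q0 : 0 <= p * \int[P]_w (xi w `^ 1).
  rewrite mulr_ge0//; first by case/andP: p01 => /ltW.
  by apply: Rintegral_ge0 => w _; exact: powR_ge0.
have gq : g * (p * \int[P]_w (xi w `^ 1)) < g by rewrite -[ltRHS]mulr1 ltr_pM2l.
have M : Num.max 1 (p * \int[P]_w (xi w `^ g)) < g by rewrite gt_max g_gt1.
(* [b] must exceed 1 and [p m_g] for the source and [g q] for the homogeneous part, yet stay below
   [g]; that [g q < g] is where strict subcriticality enters. *)
have [b []] := exists_between_max M gq; rewrite gt_max => /andP[b1 mb] gb bg.
have [K K0 HK] := subcritical_centered_moment p01 hwalk X_ge0 xi_ge0 Xs_ge0 xis_ge0
  g_gt1 g_le2 iXg ixig (ltW b1) mb gb.
have l0 : 0 <= l.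
  apply: divr_ge0; last by rewrite subr_ge0 ltW.
  by apply: mulr_ge0 => //; apply: Rintegral_ge0 => w _; exact: powR_ge0.
have ml : mean n / n%:R @[n --> \oo] --> l.
  apply: subcritical_mean => // n n0.
  exact: (meanS p01 hwalk X_ge0 xi_ge0 Xs_ge0 xis_ge0 g_gt1 iXg ixig n0).
have a0 n : (4 <= n)%N -> 0 < n%:R :> R.
  by move=> n4; rewrite ltr0n (leq_trans _ n4).
(* The [g]-th power of [ln n <= n^dl / dl] costs [n^(g - b)], exactly the room left by the moment
   bound [n^b]. *)
pose dl : R := (g - b) / g.
have dl0 : 0 < dl by rewrite divr_gt0// subr_gt0.
have K'0 : 0 <= K * (dl^-1) `^ g by rewrite mulr_ge0// powR_ge0.
have cl n : (4 <= n)%N ->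
    (\int[P]_w (`|centered n w| `^ g)) * ln n%:R `^ g <= K * (dl^-1) `^ g * n%:R `^ g.
  move=> n4; have n0 : 0 < n%:R :> R by exact: a0.
  have ln0 : 0 <= ln n%:R :> R by rewrite ln_ge0// ler1n (leq_trans _ n4).
  have lnd : ln n%:R `^ g <= (dl^-1) `^ g * n%:R `^ (g - b).
    rewrite (_ : g - b = dl * g); last by rewrite /dl divfK ?gt_eqF.
    rewrite powRrM -powRM ?powR_ge0 ?invr_ge0 ?(ltW dl0)//.
    rewrite ge0_ler_powR ?nnegrE ?(ltW g_gt0)//.
      by rewrite mulr_ge0 ?powR_ge0 ?invr_ge0 ?(ltW dl0).
    rewrite ler_pdivlMl// -ln_powR ltW// ln_sublinear//; exact: powR_gt0.
  apply: (@le_trans _ _ (K * n%:R `^ b * ((dl^-1) `^ g * n%:R `^ (g - b)))).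
    apply: ler_pM; rewrite ?powR_ge0//.
      by apply: Rintegral_ge0 => w _; exact: powR_ge0.
    by apply: HK; exact: leq_trans n4.
  rewrite mulrACA -powRD ?(gt_eqF n0) ?implybT// [b + _]addrC subrK.
  by rewrite lexx.
split.
  exact: (norming_cvg_as a0 subcritical_norming l0 K'0 ml cl).
exact: (norming_cvg_Lp a0 K'0 ml cl).
Qed.

End nonneg_walk.

(** * Reduction to nonnegative variables *)

Section reduction.
Context (d : measure_display) (T : measurableType d) (R : realType).
Variable P : probability T R.

Definition comp_RV (f : R -> R) (mf : measurable_fun setT f) (Y : {RV P >-> R}) :
    {RV P >-> R} :=
  HB.pack (f \o Y) (isMeasurableFun.Build _ _ _ _ (f \o Y)
    (measurableT_comp mf (@measurable_funPT _ _ _ _ Y))).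

Lemma same_law_comp f (mf : measurable_fun setT f) (Y Z : {RV P >-> R}) :
  same_law Y Z -> same_law (comp_RV mf Y) (comp_RV mf Z).
Proof.
move=> YZ A mA; apply: (YZ (f @^-1` A)).
by rewrite -[_ @^-1` _]setTI; exact: mf.
Qed.

(** Fixed measurable maps preserve equality of laws and shrink the generated sigma-algebras, so the
    product rule is inherited. *)
Lemma rwes_comp (p : R) (X xi : {RV P >-> R})
    (Xs : nat -> {RV P >-> R}) (eps : nat -> {RV P >-> bool})
    (U : nat -> {RV P >-> nat}) (xis : nat -> {RV P >-> R})
    (f h : R -> R) (mf : measurable_fun setT f) (mh : measurable_fun setT h) :
  is_rwes_data Xs eps U xis p X xi ->
  is_rwes_data (fun n => comp_RV mf (Xs n)) eps U (fun n => comp_RV mh (xis n)) p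
    (comp_RV mf X) (comp_RV mh xi).
Proof.
case=> hX heps hU hxi hind; split => //.
- by move=> n n1; apply: same_law_comp; exact: hX.
- by move=> n n2; apply: same_law_comp; exact: hxi.
- move=> n j E jinj jD jE; apply: (hind n j E jinj jD) => k.
  have := jE k; case: (j k) => i //= [A mA <-]; rewrite setTI.
    exact: sigma_of_comp.
  exact: sigma_of_comp.
Qed.

Lemma ae_echo_ge0 (p : R) (X xi : {RV P >-> R})
    (Xs : nat -> {RV P >-> R}) (eps : nat -> {RV P >-> bool})
    (U : nat -> {RV P >-> nat}) (xis : nat -> {RV P >-> R}) :
  is_rwes_data Xs eps U xis p X xi -> {ae P, forall w, 0 <= xi w} ->
  {ae P, forall w, forall n, (1 < n)%N -> 0 <= xis n w}.
Proof.
move=> hwalk xi0; apply: ae_foralln => n; case: (ltnP 1 n) => n1; last first.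
  by apply: aeW => w.
have mA (Y : {RV P >-> R}) : measurable (Y @^-1` `]-oo, 0[).
  exact: measurable_funPTI.
have neg (Y : {RV P >-> R}) : ~` [set w | 0 <= Y w] = Y @^-1` `]-oo, 0[.
  by apply/seteqP; split => w /=; rewrite in_itv/= ltNge => /negP.
have xi_neg : P (xi @^-1` `]-oo, 0[) = 0%E.
  by apply: measure_negligible => //; rewrite -neg.
have : P (xis n @^-1` `]-oo, 0[) = 0%E.
  by rewrite -xi_neg; exact: (rwes_echo hwalk n1 (A := `]-oo, 0[%classic)).
move=> /(negligibleP P (mA _)); rewrite -neg => H.
have {}H : {ae P, forall w, 0 <= xis n w} := H.
by apply: filterS H => w Hw _.
Qed.

Lemma echo_walkB (Xs Xp Xm : nat -> {RV P >-> R}) (eps : nat -> {RV P >-> bool})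
    (U : nat -> {RV P >-> nat}) (xis xip : nat -> {RV P >-> R}) w :
  (forall n, Xs n w = Xp n w - Xm n w) ->
  (forall n, (1 < n)%N -> xip n w = xis n w) ->
  forall n, echo_walk Xs eps U xis n w =
    echo_walk Xp eps U xip n w - echo_walk Xm eps U xip n w.
Proof.
move=> XE xiE.
have stepE k : echo_step Xs eps U xis k.+1 w =
    echo_step Xp eps U xip k.+1 w - echo_step Xm eps U xip k.+1 w.
  elim/ltn_ind: k => -[_|k IH]; first by rewrite !echo_step1.
  rewrite !echo_step_rec XE xiE//.
  rewrite (eq_bigr (fun j : 'I_k.+1 =>
    (U k.+2 w == j.+1)%:R * echo_step Xp eps U xip j.+1 w
    - (U k.+2 w == j.+1)%:R * echo_step Xm eps U xip j.+1 w)); last first.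
    by move=> j _; rewrite IH// mulrBr.
  by rewrite sumrB; ring.
case=> [|n]; first by rewrite /echo_walk !big_geq// subrr.
by rewrite !walkE -sumrB; apply: eq_bigr => j _; exact: stepE.
Qed.

Lemma ae_eq_Lnorm (g : R) (f h : T -> R) :
  measurable_fun setT f -> measurable_fun setT h -> {ae P, forall w, f w = h w} ->
  Lnorm P g%:E (EFin \o f) = Lnorm P g%:E (EFin \o h).
Proof.
move=> mf mh fh; rewrite unlock /=; congr (_ `^ _)%E.
apply: ge0_ae_eq_integral => //.
- exact/measurable_EFinP/measurable_norm_powR.
- exact/measurable_EFinP/measurable_norm_powR.
- by apply: filterS fh => w /= ->.
Qed.

Lemma cvg_asB (Y Y1 Y2 : nat -> T -> R) (l1 l2 : R) :
  {ae P, forall w, forall n, Y n w = Y1 n w - Y2 n w} ->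
  cvg_as P Y1 l1 -> cvg_as P Y2 l2 -> cvg_as P Y (l1 - l2).
Proof.
move=> YE h1 h2; apply: filterS3 YE h1 h2 => w E c1 c2.
by under eq_fun do rewrite E; exact: cvgB.
Qed.

Lemma cvg_LpB (g : R) (Y Y1 Y2 : nat -> T -> R) (l1 l2 : R) : 1 <= g ->
  (forall n, measurable_fun setT (Y n)) ->
  {ae P, forall w, forall n, Y n w = Y1 n w - Y2 n w} ->
  cvg_Lp P g Y1 l1 -> cvg_Lp P g Y2 l2 -> cvg_Lp P g Y (l1 - l2).
Proof.
move=> g1 mY YE [L1 c1] [L2 c2].
have m1 n : measurable_fun setT (Y1 n).
  by move: (L1 n); rewrite inE => /andP[]; rewrite inE.
have m2 n : measurable_fun setT (Y2 n).
  by move: (L2 n); rewrite inE => /andP[]; rewrite inE.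
have YEn n : {ae P, forall w, Y n w = Y1 n w - Y2 n w} by apply: filterS YE.
have fin (f : T -> R) : f \in Lfun P g%:E -> (Lnorm P g%:E (EFin \o f) < +oo)%E.
  by rewrite inE => /andP[_]; rewrite inE.
have LN (f : T -> R) : Lnorm P g%:E (EFin \o (fun w => - f w)) = Lnorm P g%:E (EFin \o f).
  by rewrite -[RHS]oppe_Lnorm; apply: eq_Lnorm => w.
split.
  move=> n; rewrite inE; apply/andP; split; rewrite inE/=; first exact: mY.
  rewrite /finite_norm (ae_eq_Lnorm g (mY n) (measurable_funB (m1 n) (m2 n)))//.
  apply: (le_lt_trans (minkowski_EFin P (m1 n) (measurable_funN (m2 n)) g1)).
  by rewrite lte_add_pinfty// ?LN fin.
apply: (@squeeze_cvge _ _ _ _ (fun=> 0%E) _ (fun n =>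
  (Lnorm P g%:E (fun w => (Y1 n w - l1)%:E) + Lnorm P g%:E (fun w => (Y2 n w - l2)%:E))%E)).
- apply: nearW => n; rewrite Lnorm_ge0/=.
  have mb (f : T -> R) (c : R) :
      measurable_fun setT f -> measurable_fun setT (fun w => f w - c).
    by move=> mf; apply: measurable_funB => //; exact: measurable_cst.
  rewrite (_ : (fun w => (Y n w - (l1 - l2))%:E) = EFin \o (fun w => Y n w - (l1 - l2)))//.
  rewrite (@ae_eq_Lnorm g _ (fun w => (Y1 n w - l1) + - (Y2 n w - l2))); last 3 first.
  + exact: mb.
  + by apply: measurable_funD; [exact: mb|apply: measurable_funN; exact: mb].
  + by apply: filterS (YEn n) => w ->; ring.
  have := minkowski_EFin P (mb _ l1 (m1 n)) (measurable_funN (mb _ l2 (m2 n))) g1.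
  by rewrite (LN (fun w => Y2 n w - l2)).
- exact: cvg_cst.
- rewrite -[X in _ --> X](adde0 0%E); exact: cvgeD.
Qed.

End reduction.

Section positive_part_moments.
Context {R : realType}.

Definition pos_part (x : R) : R := Num.max x 0.
Definition neg_part (x : R) : R := Num.max (- x) 0.

Lemma measurable_pos_part : measurable_fun setT pos_part.
Proof. by apply: measurable_maxr => //; exact: measurable_cst. Qed.

Lemma measurable_neg_part : measurable_fun setT neg_part.
Proof.
apply: measurable_maxr; last exact: measurable_cst.
exact: measurable_funN.
Qed.

Lemma pos_part_ge0 x : 0 <= pos_part x.
Proof. by rewrite le_max lexx orbT. Qed.

Lemma neg_part_ge0 x : 0 <= neg_part x.
Proof. by rewrite le_max lexx orbT. Qed.

Lemma pos_partB_neg_part x : x = pos_part x - neg_part x.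
Proof.
rewrite /pos_part /neg_part; case: (leP 0 x) => x0.
  by rewrite [X in _ - X]max_r ?oppr_le0// subr0.
by rewrite max_l ?oppr_ge0 1?ltW// add0r opprK.
Qed.

Lemma pos_part_powR_le (s x : R) : 0 < s -> pos_part x `^ s <= `|x| `^ s.
Proof. exact: max0_powR_le. Qed.

Lemma neg_part_powR_le (s x : R) : 0 < s -> neg_part x `^ s <= `|x| `^ s.
Proof. by move=> s0; rewrite -normrN; exact: max0_powR_le. Qed.

End positive_part_moments.

Theorem theorem1p2 (d : measure_display) (T : measurableType d) (R : realType)
    (P : probability T R) (p : R) (X xi : {RV P >-> R})
    (Xs : nat -> {RV P >-> R}) (eps : nat -> {RV P >-> bool})
    (U : nat -> {RV P >-> nat}) (xis : nat -> {RV P >-> R})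
    (hp : 0 < p <= 1)
    (hX0 : (P [set w | X w = 0%R] < 1)%E)
    (hxi0 : (P [set w | xi w = 0%R] < 1)%E)
    (hxi : {ae P, forall w, 0 <= xi w})
    (hL : exists alpha : R, 1 < alpha /\
       (X : T -> R) \in Lfun P alpha%:E /\ (xi : T -> R) \in Lfun P alpha%:E)
    (hwalk : is_rwes_data Xs eps U xis p X xi)
    (hm1 : (p%:E * 'E_P[xi] <= 1)%E) :
  exists gamma : R, 1 < gamma /\
    ((p%:E * 'E_P[xi] = 1)%E ->
     ('E_P[fun w => (xi w * ln (xi w))%R] < 'E_P[xi])%E ->
       let Y := fun n w => echo_walk Xs eps U xis n w / (n%:R * ln n%:R) in
       let l := (1 - p) * fine 'E_P[X] in
       cvg_as P Y l /\ cvg_Lp P gamma Y l) /\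
    ((p%:E * 'E_P[xi] < 1)%E ->
       let Y := fun n w => echo_walk Xs eps U xis n w / n%:R in
       let l := (1 - p) * fine 'E_P[X] / (1 - p * fine 'E_P[xi]) in
       cvg_as P Y l /\ cvg_Lp P gamma Y l).
Proof.
have [alpha [a1 [LX Lxi]]] := hL.
have a0 : 0 < alpha by exact: lt_trans a1.
have mpos := @measurable_pos_part R; have mneg := @measurable_neg_part R.
(* The two spin walks share coins, recalls and echoes. Echoes are replaced by their positive parts
   to be nonnegative at every point and not just almost surely; this alters the walk on a null set
   only. *)
pose Xp := comp_RV mpos X; pose Xm := comp_RV mneg X; pose xip := comp_RV mpos xi.
pose Xsp n := comp_RV mpos (Xs n); pose Xsm n := comp_RV mneg (Xs n).
pose xisp n := comp_RV mpos (xis n).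
have dp : is_rwes_data Xsp eps U xisp p Xp xip by exact: rwes_comp.
have dm : is_rwes_data Xsm eps U xisp p Xm xip by exact: rwes_comp.
have mRV (Y : {RV P >-> R}) : measurable_fun setT Y by exact: measurable_funPT.
have mpow (Y : {RV P >-> R}) s : measurable_fun setT (fun w => Y w `^ s).
  exact: (measurableT_comp (measurable_powR s) (mRV Y)).
have iXa := Lfun_integrable (ltW a1) LX.
have ixia := Lfun_integrable (ltW a1) Lxi.
have ipow (Y Z : {RV P >-> R}) s : 0 < s -> s <= alpha ->
    P.-integrable setT (EFin \o (fun w => `|Z w| `^ alpha)) ->
    (forall w, Y w `^ s <= `|Z w| `^ s) ->
    P.-integrable setT (EFin \o (fun w => Y w `^ s)).
  move=> s0 sa iZ YZ; apply: (integrable_le (g := fun w => 1 + `|Z w| `^ alpha)) => //.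
    move=> w; rewrite ger0_norm ?powR_ge0// (le_trans (YZ w))//.
    by rewrite ler_powR_1D// ltW.
  by apply: integrableDr => //; exact: integrable_cst.
have iXp s : 0 < s -> s <= alpha -> P.-integrable setT (EFin \o (fun w => Xp w `^ s)).
  by move=> s0 sa; apply: (ipow Xp X) => // w; exact: pos_part_powR_le.
have iXm s : 0 < s -> s <= alpha -> P.-integrable setT (EFin \o (fun w => Xm w `^ s)).
  by move=> s0 sa; apply: (ipow Xm X) => // w; exact: neg_part_powR_le.
have ixip s : 0 < s -> s <= alpha -> P.-integrable setT (EFin \o (fun w => xip w `^ s)).
  by move=> s0 sa; apply: (ipow xip xi) => // w; exact: pos_part_powR_le.
have i1 (Y : {RV P >-> R}) : (forall w, 0 <= Y w) ->
    P.-integrable setT (EFin \o (fun w => Y w `^ 1)) -> P.-integrable setT (EFin \o Y).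
  by move=> Y0; under eq_fun do rewrite powRr1//.
have Xp0 w : 0 <= Xp w by exact: pos_part_ge0.
have Xm0 w : 0 <= Xm w by exact: neg_part_ge0.
have xip0 w : 0 <= xip w by exact: pos_part_ge0.
have JXp := i1 _ Xp0 (iXp 1 ltr01 (ltW a1)).
have JXm := i1 _ Xm0 (iXm 1 ltr01 (ltW a1)).
have Jxip := i1 _ xip0 (ixip 1 ltr01 (ltW a1)).
have xi_ae : {ae P, forall w, xi w = xip w}.
  by apply: filterS hxi => w xw; rewrite /xip /= /pos_part max_l.
have EX : fine 'E_P[X] = \int[P]_w Xp w - \int[P]_w Xm w.
  rewrite -RintegralB// unlock; congr fine; apply: eq_integral => w _.
  by rewrite {1}(pos_partB_neg_part (X w)).
have Exi : ('E_P[xi] = (\int[P]_w xip w)%:E)%E.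
  rewrite -EFin_Rintegral// unlock; apply: ae_eq_integral => //.
  - exact/measurable_EFinP.
  - exact/measurable_EFinP.
  - by apply: filterS xi_ae => w xw _; exact: (congr1 EFin xw).
have Jln := integrable_mul_ln a1 (mRV xip) xip0 (ixip alpha a0 (lexx _)).
have Eln : ('E_P[fun w => (xi w * ln (xi w))%R] =
    (\int[P]_w (xip w * ln (xip w)))%:E)%E.
  rewrite -EFin_Rintegral// unlock; apply: ae_eq_integral => //.
  - apply/measurable_EFinP; apply: measurable_funM => //.
    exact: (measurableT_comp (@measurable_ln R) (mRV xi)).
  - apply/measurable_EFinP; apply: measurable_funM => //.
    exact: (measurableT_comp (@measurable_ln R) (mRV xip)).
  - by apply: filterS xi_ae => w xw _; exact: (congr1 (fun x => (x * ln x)%:E) xw).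
have walkE : {ae P, forall w, forall n, echo_walk Xs eps U xis n w =
    echo_walk Xsp eps U xisp n w - echo_walk Xsm eps U xisp n w}.
  apply: filterS (ae_echo_ge0 hwalk hxi) => w Hw; apply: echo_walkB.
    by move=> n; exact: pos_partB_neg_part.
  by move=> n n1; rewrite /xisp /= /pos_part max_l// Hw.
have combine (a : nat -> R) g lp lm : 1 < g ->
    cvg_as P (fun n w => echo_walk Xsp eps U xisp n w / a n) lp /\
    cvg_Lp P g (fun n w => echo_walk Xsp eps U xisp n w / a n) lp ->
    cvg_as P (fun n w => echo_walk Xsm eps U xisp n w / a n) lm /\
    cvg_Lp P g (fun n w => echo_walk Xsm eps U xisp n w / a n) lm ->
    cvg_as P (fun n w => echo_walk Xs eps U xis n w / a n) (lp - lm) /\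
    cvg_Lp P g (fun n w => echo_walk Xs eps U xis n w / a n) (lp - lm).
  move=> g1 [c1 c2] [c3 c4].
  have YE : {ae P, forall w, forall n, echo_walk Xs eps U xis n w / a n =
      echo_walk Xsp eps U xisp n w / a n - echo_walk Xsm eps U xisp n w / a n}.
    by apply: filterS walkE => w Hw n; rewrite Hw mulrBl.
  split; first exact: cvg_asB c1 c3.
  apply: cvg_LpB c2 c4 => //; first exact: ltW.
  move=> n; apply: measurable_funM; last exact: measurable_cst.
  exact: measurable_walk.
have Xsp0 n w : 0 <= Xsp n w by exact: pos_part_ge0.
have Xsm0 n w : 0 <= Xsm n w by exact: neg_part_ge0.
have xisp0 n w : 0 <= xisp n w by exact: pos_part_ge0.
have p0 : 0 < p by case/andP: hp.
rewrite EX Exi Eln /= -!EFinM.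
(* One exponent has to serve both claims, so it is chosen before they are separated. If neither set
   of hypotheses holds, both implications are vacuous and 2 will do. *)
have [hyp|hyp] := pselect (p * (\int[P]_w xip w) < 1 \/
  (p * (\int[P]_w xip w) = 1 /\ \int[P]_w (xip w * ln (xip w)) < \int[P]_w xip w));
  last first.
  exists 2; split; first by rewrite ltr1n.
  split; first by move=> [q1]; rewrite lte_fin => e1; exfalso; apply: hyp; right.
  by rewrite lte_fin => q1; exfalso; apply: hyp; left.
have [g [g1 g2 ga mg]] := moment_exponent_exists p0 a1 (mRV xip) xip0
  (ixip alpha a0 (lexx _)) hyp.
have g0 : 0 < g by exact: lt_trans g1.
exists g; split => //; split.
  move=> [q1] _; rewrite mulrBr.
  apply: (combine (fun n => n%:R * ln n%:R)) => //.
    exact: (critical_nonneg hp dp Xp0 xip0 Xsp0 xisp0 g1 g2 (iXp g g0 ga)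
      (ixip g g0 ga) mg q1).
  exact: (critical_nonneg hp dm Xm0 xip0 Xsm0 xisp0 g1 g2 (iXm g g0 ga)
    (ixip g g0 ga) mg q1).
rewrite lte_fin => q1; rewrite mulrBr mulrBl.
apply: (combine (fun n => n%:R)) => //.
  exact: (subcritical_nonneg hp dp Xp0 xip0 Xsp0 xisp0 g1 g2 (iXp g g0 ga)
    (ixip g g0 ga) mg q1).
exact: (subcritical_nonneg hp dm Xm0 xip0 Xsm0 xisp0 g1 g2 (iXm g g0 ga)
  (ixip g g0 ga) mg q1).
Qed.
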